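(* Let $F=\alpha+\beta$ be a Randers metric on an $n$-dimensional manifold $M$, where $\alpha=\sqrt{a_{ij}(x)y^iy^j}$ is a Riemannian metric and $\beta=b_i(x)y^i$ is a nowhere vanishing 1-form with $\|\beta_x\|_\alpha<1$ for all $x\in M$. Suppose that $\beta$ is a Killing 1-form with respect to $\alpha$. If $F$ is of scalar flag curvature $\mathbf{K}=\mathbf{K}(x,y)$, then there are scalar functions $c=c(x)$ and $\lambda=\lambda(x)$ on $M$ such that, for all $x\in M$ and $y\in T_xM$, $$t_0=-\frac{n-1}{n+1}\left(\lambda+c\,b^{-2}\right)\beta,$$ where $b:=\|\beta_x\|_\alpha$ denotes the norm of $\beta$ with respect to $\alpha$.
   Context: Local coordinates $(x^i)$ on $M$ induce coordinates $(x^i,y^i)$ on $TM$. Indices are raised and lowered with $(a_{ij})$ and its inverse $(a^{ij})$; $b^i:=a^{ij}b_j$, $b^2=\|\beta_x\|_\alpha^2=a^{ij}b_ib_j$. The symbol '';'' denotes the covariant derivative with respect to the Levi-Civita connection of $\alpha$. The 1-form $\beta$ is Killing with respect to $\alpha$ if $b_{i;j}+b_{j;i}=0$. Notation: $s_{ij}:=\frac12(b_{i;j}-b_{j;i})$, $s^i_{\ j}:=a^{ik}s_{kj}$, $t_{ij}:=s_{im}s^m_{\ j}$, $t_i:=b^jt_{ji}$, $t_0:=t_iy^i$. Scalar flag curvature: let $g_{ij}=\frac12[F^2]_{y^iy^j}$, let $G^i=\frac14 g^{il}\{[F^2]_{x^ky^l}y^k-[F^2]_{x^l}\}$ be the geodesic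 coefficients of $F$, and let $$R^i_{\ k}=2\frac{\partial G^i}{\partial x^k}-\frac{\partial^2G^i}{\partial x^m\partial y^k}y^m+2G^m\frac{\partial^2G^i}{\partial y^m\partial y^k}-\frac{\partial G^i}{\partial y^m}\frac{\partial G^m}{\partial y^k}$$ be the Riemann curvature. The flag curvature of a plane $P=\mathrm{span}\{y,u\}$ with flagpole $y$ is $\mathbf{K}(x,y,P)=\dfrac{g_y(\mathbf{R}_y(u),u)}{g_y(y,y)g_y(u,u)-[g_y(u,y)]^2}$. $F$ is of scalar flag curvature $\mathbf{K}(x,y)$ if $\mathbf{K}$ is independent of $P$ containing $y$, i.e. it is a scalar function on $TM\setminus\{0\}$; equivalently $R^i_{\ k}=\mathbf{K}(x,y)\left(F^2\delta^i_{\ k}-FF_{y^k}y^i\right)$. *)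

(* Defs.v *)
From HB Require Import structures.
From mathcomp Require Import all_boot all_order all_algebra.
From mathcomp Require Import all_classical all_reals all_analysis.
Set Implicit Arguments.
Unset Strict Implicit.
Unset Printing Implicit Defensive.
Import Order.TTheory GRing.Theory Num.Theory.
Import numFieldNormedType.Exports.
Local Open Scope classical_set_scope.
Local Open Scope ring_scope.

Section Calculus.
Variables (R : realType) (n : nat).
Implicit Types (f : 'rV[R]_n -> R) (h : 'rV[R]_n -> 'rV[R]_n -> R).

Definition partial (k : 'I_n) f (x : 'rV[R]_n) : R := 'D_(delta_mx 0 k) f x.

(* C^infinity on an open set U: every iterated partial derivative exists and
   is Frechet differentiable (hence continuous) at every point of U. *)
Definition smooth_on (U : set 'rV[R]_n) f : Prop :=
  forall (s : seq 'I_n) x, U x -> differentiable (foldr partial f s) x.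

(* For h = h(x, y): the partial derivatives in x^k and in y^k. *)
Definition dx (k : 'I_n) h : 'rV[R]_n -> 'rV[R]_n -> R :=
  fun x y => partial k (h^~ y) x.
Definition dy (k : 'I_n) h : 'rV[R]_n -> 'rV[R]_n -> R :=
  fun x y => partial k (h x) y.

End Calculus.

(* A tensor is represented by its components in the charts, as functions of
   the coordinates x; they are only meaningful on the open image of the
   chart. *)
Section LocalRiemannian.
Variables (R : realType) (n : nat).
Variables (a : 'rV[R]_n -> 'M[R]_n) (b : 'rV[R]_n -> 'rV[R]_n).
Implicit Types (i j k : 'I_n) (x y : 'rV[R]_n).

Definition inv_metric x : 'M[R]_n := invmx (a x).

Definition christoffel k i j x : R :=
  2^-1 * \sum_l inv_metric x k l *
    (partial i (fun z => a z j l) x + partial j (fun z => a z i l) x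
     - partial l (fun z => a z i j) x).

(* b_{i;j} *)
Definition cov_deriv i j x : R :=
  partial j (fun z => b z 0 i) x - \sum_k christoffel k i j x * b x 0 k.

Definition killing_at x : Prop :=
  forall i j, cov_deriv i j x + cov_deriv j i x = 0.

Definition b_up i x : R := \sum_j inv_metric x i j * b x 0 j.

Definition beta_norm x : R :=
  Num.sqrt (\sum_i \sum_j inv_metric x i j * b x 0 i * b x 0 j).

Definition alpha x y : R := Num.sqrt (\sum_i \sum_j a x i j * y 0 i * y 0 j).

Definition beta x y : R := \sum_i b x 0 i * y 0 i.

Definition randers x y : R := alpha x y + beta x y.

Definition s_low i j x : R := 2^-1 * (cov_deriv i j x - cov_deriv j i x).

Definition s_mixed i j x : R := \sum_k inv_metric x i k * s_low k j x.

Definition t_low i j x : R := \sum_m s_low i m x * s_mixed m j x.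

Definition t_vec i x : R := \sum_j b_up j x * t_low j i x.

Definition t0 x y : R := \sum_i t_vec i x * y 0 i.

End LocalRiemannian.

Section LocalFinsler.
Variables (R : realType) (n : nat).
Variable F : 'rV[R]_n -> 'rV[R]_n -> R.
Implicit Types (i k l m : 'I_n) (x y u : 'rV[R]_n).

Definition F2 x y : R := F x y ^+ 2.

Definition fund_tensor x y : 'M[R]_n :=
  \matrix_(i, j) (2^-1 * dy j (dy i F2) x y).

Definition geod_coef i x y : R :=
  4^-1 * \sum_l invmx (fund_tensor x y) i l *
    (\sum_k dy l (dx k F2) x y * y 0 k - dx l F2 x y).

(* R^i_k *)
Definition riemann_curv i k x y : R :=
  2 * dx k (geod_coef i) x y
  - \sum_m dy k (dx m (geod_coef i)) x y * y 0 m
  + 2 * \sum_m geod_coef m x y * dy k (dy m (geod_coef i)) x y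
  - \sum_m dy m (geod_coef i) x y * dy k (geod_coef m) x y.

(* g_y(u, v) *)
Definition fund_form x y (u v : 'rV[R]_n) : R :=
  \sum_i \sum_j fund_tensor x y i j * u 0 i * v 0 j.

(* R_y(u) *)
Definition riemann_op x y u : 'rV[R]_n :=
  \row_i \sum_k riemann_curv i k x y * u 0 k.

Definition flag_curv x y u : R :=
  fund_form x y (riemann_op x y u) u /
  (fund_form x y y y * fund_form x y u u - fund_form x y u y ^+ 2).

End LocalFinsler.

(* chart_inv i inverts chart_map i on the image of chart_dom i; the values of
   chart_map i outside chart_dom i, and those of chart_inv i outside the image
   of the chart, are irrelevant. *)
Record smooth_manifold (R : realType) (n : nat) (M : topologicalType) := {
  chart : Type;
  chart_dom : chart -> set M;
  chart_map : chart -> M -> 'rV[R]_n;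
  chart_inv : chart -> 'rV[R]_n -> M;
  mf_hausdorff : hausdorff_space M;
  mf_second_countable : @second_countable M;
  mf_dom_open : forall i, open (chart_dom i);
  mf_cover : forall p, exists i, chart_dom i p;
  mf_image_open : forall i, open (chart_map i @` chart_dom i);
  mf_coordK : forall i p, chart_dom i p -> chart_inv i (chart_map i p) = p;
  mf_coord_continuous :
    forall i, {within chart_dom i, continuous (chart_map i)};
  mf_param_continuous :
    forall i, {within chart_map i @` chart_dom i, continuous (chart_inv i)};
  mf_transition_smooth : forall i j (k : 'I_n),
    smooth_on (chart_map i @` (chart_dom i `&` chart_dom j))
      (fun x => chart_map j (chart_inv i x) 0 k)
}.

Section Tensors.
Variables (R : realType) (n : nat) (M : topologicalType).
Variable A : smooth_manifold R n M.

(* The matrix (d x'^q / d x^k)_{k,q} at p of the change of coordinates from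
   the chart i (coordinates x) to the chart j (coordinates x'). *)
Definition trans_jacobian (i j : chart A) (p : M) : 'M[R]_n :=
  'J (chart_map j \o chart_inv i) (chart_map i p).

Record riemannian_metric := {
  met :> chart A -> 'rV[R]_n -> 'M[R]_n;
  met_smooth : forall i (k l : 'I_n),
    smooth_on (chart_map i @` chart_dom i) (fun x => met i x k l);
  met_sym : forall i p, chart_dom i p ->
    (met i (chart_map i p))^T = met i (chart_map i p);
  met_pos : forall i p, chart_dom i p -> forall y : 'rV[R]_n, y != 0 ->
    0 < (y *m met i (chart_map i p) *m y^T) 0 0;
  met_trans : forall i j p, chart_dom i p -> chart_dom j p ->
    met i (chart_map i p) =
      trans_jacobian i j p *m met j (chart_map j p) *m (trans_jacobian i j p)^T
}.

Record one_form := {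
  form :> chart A -> 'rV[R]_n -> 'rV[R]_n;
  form_smooth : forall i (k : 'I_n),
    smooth_on (chart_map i @` chart_dom i) (fun x => form i x 0 k);
  form_trans : forall i j p, chart_dom i p -> chart_dom j p ->
    form i (chart_map i p) = form j (chart_map j p) *m (trans_jacobian i j p)^T
}.

(* A function on TM \ {0}: the tangent vector at p with components y in the
   chart i has components y *m trans_jacobian i j p in the chart j. *)
Record slit_function := {
  slit :> chart A -> 'rV[R]_n -> 'rV[R]_n -> R;
  slit_trans : forall i j p, chart_dom i p -> chart_dom j p ->
    forall y : 'rV[R]_n, y != 0 ->
    slit i (chart_map i p) y =
      slit j (chart_map j p) (y *m trans_jacobian i j p)
}.

Definition nowhere_vanishing (b : one_form) : Prop :=
  forall i p, chart_dom i p -> b i (chart_map i p) != 0.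

Definition norm_lt1 (a : riemannian_metric) (b : one_form) : Prop :=
  forall i p, chart_dom i p -> beta_norm (a i) (b i) (chart_map i p) < 1.

Definition killing (a : riemannian_metric) (b : one_form) : Prop :=
  forall i p, chart_dom i p -> killing_at (a i) (b i) (chart_map i p).

(* Independence of the flag: every plane P = span{y, u}, with u not collinear
   to the flagpole y, has flag curvature K(x, y). *)
Definition scalar_flag_curvature
    (F : chart A -> 'rV[R]_n -> 'rV[R]_n -> R) (K : slit_function) : Prop :=
  forall i p, chart_dom i p -> forall y u : 'rV[R]_n, row_free (col_mx y u) ->
    flag_curv (F i) (chart_map i p) y u = K i (chart_map i p) y.

End Tensors.

(* Main.v *)
(* Everything but the choice of charts happens at one point x. Up to a projective
   factor, which scalar flag curvature does not see, the spray of F is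
   1/2 Gamma(y, y) + alpha s#y, where s#y = s^i_0; so the hypothesis reads, for u
   orthogonal to y,
     <R(u, y)y, u> + 3 s(u, y)^2 + |y|^2 |s#u|^2 + 2 |y| <(nabla_u s#)y, u> = A(y) |u|^2.
   Only the last term on the left is odd in y. The odd part, compared for the edges
   b and u, and the identity <(nabla_u s#)y, u> = - <R(u, y)u, b> of a Killing form,
   give <R(u, y)u, b> = 0 whenever y, u, b are mutually orthogonal. Polarizing the
   even part with flagpole u between the edges y + b and y - b then yields
     |u|^2 <s#y, s#b> = - 3 <s#y, u> <s#b, u>.
   For u the component of s#y orthogonal to b this forces <s#y, s#b> = 0: t_0, which
   is - <s#b, s#y>, vanishes on the orthogonal of b and hence equals mu beta. Since s
   is a tensor, mu does not depend on the chart, and c = 0 works; for n = 1, where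
   (n - 1) / (n + 1) = 0, the form s itself vanishes. *)
Require Import Defs.
From HB Require Import structures.
From mathcomp Require Import all_boot all_order all_algebra.
From mathcomp Require Import all_classical all_reals all_analysis.
From mathcomp Require Import ring lra.
Set Implicit Arguments.
Unset Strict Implicit.
Unset Printing Implicit Defensive.
Import Order.TTheory GRing.Theory Num.Theory.
Import numFieldNormedType.Exports.
Local Open Scope classical_set_scope.
Local Open Scope ring_scope.

(** * Differentiation of real functions on a normed space *)

Section PointwiseRules.
Variables (R : realType) (V : normedModType R).
Implicit Types (f g : V -> R) (x v : V).

(** Inverting g_y directly would be unwieldy. The spray is instead taken from the classical formula
    and checked against the Euler-Lagrange equations, which determine it since g_y is nondegenerate.
    Its projective part P y adds to R^i_k only multiples of delta^i_k and of y^i: the former are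
    absorbed in A(y), the latter are orthogonal to u. K need not be even in y, so the even and odd
    parts are separated by using the two flagpoles y and -y together, each with its own value of K.
    The edge b is special because <R(b, y)b, b> = 0: through the Killing identity this makes the
    factor of the odd part zero as soon as y is orthogonal to b. In the even part this removes
    exactly the curvature terms that mix y and b, and leaves a relation in s alone. The functions c
    and lambda occur only in the combination lambda + c b^-2, which is why c can be chosen
    freely. *)

Lemma near_eq_differentiable f g x :
  (\near x, f x = g x) -> differentiable f x -> differentiable g x.
Proof.
move=> fg df; have [fc fE] := (diff_locallyP _ _).1 df.
have gx : g x = f x by rewrite (nbhs_singleton fg).
have gE : g \o shift x = cst (g x) + 'd f x +o_ (0 : V) id.
  apply/eqaddoP => _/posnumP[e].
  have /eqaddoP /(_ e%:num) /(_ [gt0 of e%:num]) := fE.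
  rewrite /= !near_simpl.
  have : \forall h \near (0 : V), f (h + x) = g (h + x).
    by move/nbhs0P: fg; apply: filterS => h; rewrite addrC.
  apply: filterS2 => h hE.
  by rewrite -![(_ + _ : _ -> _) _]/(_ + _) -![(- _ : _ -> _) _]/(- _) /cst /= hE gx.
by apply/diff_locallyP; rewrite (diff_unique _ gE).
Qed.

Lemma is_deriveD_pt f g x v (df dg : R) :
  is_derive x v f df -> is_derive x v g dg ->
  is_derive x v (fun z => f z + g z) (df + dg).
Proof. exact: is_deriveD. Qed.

Lemma is_deriveN_pt f x v (df : R) :
  is_derive x v f df -> is_derive x v (fun z => - f z) (- df).
Proof. exact: is_deriveN. Qed.

Lemma is_deriveB_pt f g x v (df dg : R) :
  is_derive x v f df -> is_derive x v g dg ->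
  is_derive x v (fun z => f z - g z) (df - dg).
Proof. exact: is_deriveB. Qed.

Lemma is_deriveM_pt f g x v (df dg : R) :
  is_derive x v f df -> is_derive x v g dg ->
  is_derive x v (fun z => f z * g z) (f x * dg + g x * df).
Proof. exact: is_deriveM. Qed.

Lemma is_derive_cst_pt (c : R) x v : is_derive x v (fun=> c) 0.
Proof. exact: is_derive_cst. Qed.

Lemma is_deriveV_pt f x v (df : R) : f x != 0 ->
  is_derive x v f df -> is_derive x v (fun z => (f z)^-1) (- df / f x ^+ 2).
Proof.
move=> f0 fD; apply: DeriveDef; first exact: derivableV.
by rewrite deriveV // derive_val scaleNr mulNr [_^-1 *: _]mulrC.
Qed.

Lemma is_derive_sum_pt m (h : 'I_m -> V -> R) (dh : 'I_m -> R) x v :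
  (forall i, is_derive x v (h i) (dh i)) ->
  is_derive x v (fun z => \sum_i h i z) (\sum_i dh i).
Proof. by move=> hD; rewrite -fct_sumE; exact: is_derive_sum. Qed.

Lemma derive_line f x v : 'D_1 (fun t : R => f (t *: v + x)) (0 : R) = 'D_v f x.
Proof.
rewrite /derive; apply: (congr1 (fun d : R -> R => lim (d @ 0^'))).
by apply/funext => h /=; rewrite addr0 scale0r add0r [_%:A]mulr1.
Qed.

(** Only the derivative of [f] along [v] is given, so [f] is restricted to the line through [x] with
    direction [v], where the one-variable chain rule applies. *)
Lemma is_derive_comp_pt (s : R -> R) f x v (df ds : R) :
  is_derive (f x) 1 s ds -> is_derive x v f df ->
  is_derive x v (fun z => s (f z)) (df * ds).
Proof.
move=> sD [fd fE].
have lineD : is_derive (0 : R) 1 (fun t : R => f (t *: v + x)) df.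
  by apply: DeriveDef; [exact: (derivable1P _ _ _).1|rewrite derive_line].
have {}sD : is_derive ((fun t : R => f (t *: v + x)) 0) 1 s ds.
  by rewrite scale0r add0r.
have [cd cE] := is_derive1_comp sD lineD.
apply: DeriveDef; first exact: (derivable1P _ _ _).2 cd.
by rewrite mulrC -cE -derive_line.
Qed.

Lemma is_derive_sqrt_pt f x v (df : R) : 0 < f x -> is_derive x v f df ->
  is_derive x v (fun z => Num.sqrt (f z)) (df / (2 * Num.sqrt (f x))).
Proof. by move=> f0; apply: is_derive_comp_pt; exact: is_derive1_sqrt. Qed.

Lemma derive_comb f x (u v : V) (c : R) : differentiable f x ->
  'D_(c *: u + v) f x = c * 'D_u f x + 'D_v f x.
Proof. by move=> df; rewrite !deriveE // linearP. Qed.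

Lemma differentiable_sum_pt (I : Type) (r : seq I) (P : pred I) (h : I -> V -> R) x :
  (forall i, differentiable (h i) x) ->
  differentiable (fun z => \sum_(i <- r | P i) h i z) x.
Proof.
move=> hD; elim: r => [|i r IH].
  rewrite (_ : (fun _ => _) = cst 0); first exact: differentiable_cst.
  by apply/funext => z; rewrite big_nil.
rewrite (_ : (fun _ => _) = (if P i then h i else cst 0) +
    (fun z => \sum_(i <- r | P i) h i z)).
  by apply: differentiableD => //; case: ifP => _ //; exact: differentiable_cst.
by apply/funext => z; rewrite big_cons fctE; case: ifP => // _; rewrite add0r.
Qed.

Lemma differentiable_prod_pt (I : Type) (r : seq I) (h : I -> V -> R) x :
  (forall i, differentiable (h i) x) ->
  differentiable (fun z => \prod_(i <- r) h i z) x.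
Proof.
move=> hD; elim: r => [|i r IH].
  rewrite (_ : (fun _ => _) = cst 1); first exact: differentiable_cst.
  by apply/funext => z; rewrite big_nil.
rewrite (_ : (fun _ => _) = h i * (fun z => \prod_(i <- r) h i z)).
  exact: differentiableM.
by apply/funext => z; rewrite big_cons.
Qed.

Lemma differentiableM_pt f g x : differentiable f x -> differentiable g x ->
  differentiable (fun z => f z * g z) x.
Proof. exact: differentiableM. Qed.

Lemma differentiableD_pt f g x : differentiable f x -> differentiable g x ->
  differentiable (fun z => f z + g z) x.
Proof. exact: differentiableD. Qed.

Lemma differentiableB_pt f g x : differentiable f x -> differentiable g x ->
  differentiable (fun z => f z - g z) x.
Proof. exact: differentiableB. Qed.

Lemma differentiableMl_pt (c : R) f x : differentiable f x ->
  differentiable (fun z => c * f z) x.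
Proof. by apply: differentiableM_pt; exact: differentiable_cst. Qed.

Lemma differentiable_det m (A : V -> 'M[R]_m) x :
  (forall i j, differentiable (fun z => A z i j) x) ->
  differentiable (fun z => \det (A z)) x.
Proof.
move=> Ad; apply: differentiable_sum_pt => s.
apply: differentiableMl_pt; exact: differentiable_prod_pt.
Qed.

(** Cramer's rule. Invertibility is asked for near [x], because [invmx] returns a singular matrix
    unchanged. *)
Lemma differentiable_invmx m (A : V -> 'M[R]_m) x i j :
  (forall i j, differentiable (fun z => A z i j) x) ->
  (\near x, A x \in unitmx) -> differentiable (fun z => invmx (A z) i j) x.
Proof.
move=> Ad Au.
apply: (@near_eq_differentiable (fun z => (\det (A z))^-1 * cofactor (A z) j i)).
  by move: Au; apply: filterS => z Az; rewrite /invmx Az !mxE.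
apply: differentiableM_pt.
  apply: differentiableV; first exact: differentiable_det.
  by have := nbhs_singleton Au; rewrite unitmxE unitfE.
apply: differentiableMl_pt; apply: differentiable_det => k l.
rewrite (_ : (fun _ => _) = (fun z => A z (lift j k) (lift i l))) //.
by apply/funext => z; rewrite !mxE.
Qed.

Lemma near_neq0 (y : V) : y != 0 -> \forall z \near y, z != 0.
Proof.
move=> y0; apply/nbhs_ballP; exists `|y| => /=; first by rewrite normr_gt0.
move=> z; rewrite -ball_normE /=; apply: contraTneq => ->.
by rewrite subr0 ltxx.
Qed.

End PointwiseRules.

(** * Symmetry of second derivatives *)

Section SymmetryOfSecondDerivatives.
Variables (R : realType) (V : normedModType R).
Implicit Types (f g : V -> R) (x u v w : V).

Lemma is_derive_along_line f w u (s : R) : derivable f (s *: u + w) u ->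
  is_derive s 1 (fun t : R => f (t *: u + w)) ('D_u f (s *: u + w)).
Proof.
move=> fd.
have E : (fun h : R => h^-1 *: (((fun t : R => f (t *: u + w)) \o shift s) (h *: (1 : R))
           - f (s *: u + w))) =
         (fun h : R => h^-1 *: ((f \o shift (s *: u + w)) (h *: u) - f (s *: u + w))).
  by apply/funext => h /=; rewrite [_%:A]mulr1 scalerDl addrA.
by apply: DeriveDef; rewrite /derivable /derive E.
Qed.

Let second_difference f x u v (t : R) :=
  f (t *: u + (t *: v + x)) - f (t *: u + x) - (f (t *: v + x) - f x).

(** The mean value theorem along [u] turns the second difference into a first difference of
    ['D_u f], which the differential of ['D_u f] at [x] approximates. Differentiability at the
    single point [x] thus replaces continuity of the second derivatives. *)
Lemma second_difference_bound f x u v (e : R) : 0 < e ->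
  (\near x, differentiable f x) -> differentiable ('D_u f) x ->
  exists2 d : R, 0 < d & forall t, 0 < t < d ->
    `|second_difference f x u v t - t ^+ 2 * 'D_v ('D_u f) x| <= e * t ^+ 2.
Proof.
move=> e0 fd gd; set g := 'D_u f in gd *.
(* The two remainders below are at most [e'] times |cu + tv| and |cu|, in total
   [e' * t * (2 |u| + |v|)]; the 1 keeps the denominator positive. *)
pose e' := e / (2 * `|u| + `|v| + 1).
have N0 : 0 < 2 * `|u| + `|v| + 1.
  by rewrite ltr_wpDl // addr_ge0 // mulr_ge0.
have e'0 : 0 < e' by rewrite divr_gt0.
have [d1 d10 Hd1] : exists2 d : R, 0 < d & forall h, `|h| < d ->
    `|g (h + x) - g x - 'd g x h| <= e' * `|h|.
  have /eqaddoP /(_ _ e'0) := diff_locally gd.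
  move=> /nbhs_ballP [d d0 Hd]; exists d => // h hd.
  have := Hd h; rewrite -ball_normE /= sub0r normrN => /(_ hd).
  by rewrite -![(_ + _ : _ -> _) _]/(_ + _) -![(- _ : _ -> _) _]/(- _) /cst /= opprD addrA.
move/nbhs_ballP: fd => [d2 d20 Hd2].
have {}Hd2 h : `|h| < d2 -> differentiable f (h + x).
  by move=> hd; apply: Hd2; rewrite -ball_normE /= opprD addrCA subrr addr0 normrN.
pose d := Num.min d1 d2.
have d0 : 0 < d by rewrite lt_min d10.
exists (d / (`|u| + `|v| + 1)); first by rewrite divr_gt0 // ltr_wpDl // addr_ge0.
move=> t /andP[t0]; rewrite ltr_pdivlMr ?ltr_wpDl // ?addr_ge0 // => td.
have small (s q : R) : 0 <= s <= t -> 0 <= q <= t -> `|s *: u + q *: v| < d.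
  move=> /andP[s0 st] /andP[q0 qt]; apply: le_lt_trans td.
  apply: le_trans (ler_normD _ _) _; rewrite !normrZ !ger0_norm //.
  rewrite !mulrDr mulr1 -[leLHS]addr0; apply: lerD; last exact: ltW.
  by apply: lerD; apply: ler_wpM2r.
have fD (s q : R) : 0 <= s <= t -> 0 <= q <= t ->
    is_derive s 1 (fun s => f (s *: u + (q *: v + x))) (g (s *: u + (q *: v + x))).
  move=> st qt; apply: is_derive_along_line; apply: diff_derivable.
  by rewrite addrA; apply: Hd2; apply: lt_le_trans (small _ _ st qt) _; rewrite ge_min lexx orbT.
have tt : 0 <= t <= t by rewrite lexx ltW.
have zt : (0:R) <= 0 <= t by rewrite lexx ltW.
(* The term [0 *: v] gives both summands the shape required by [fD]. *)
pose phi (s : R) := f (s *: u + (t *: v + x)) - f (s *: u + (0 *: v + x)).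
pose dphi (s : R) := g (s *: u + (t *: v + x)) - g (s *: u + (0 *: v + x)).
have phiD (s : R) : 0 <= s <= t -> is_derive s 1 phi (dphi s).
  by move=> st; apply: is_deriveB_pt; apply: fD.
have [||c + Ec] := @MVT R phi dphi 0 t t0.
- by move=> s; rewrite in_itv /= => /andP[/ltW s0 /ltW st]; apply: phiD; rewrite s0.
- apply: derivable_within_continuous => s; rewrite in_itv /= => st.
  by have := phiD s st; case.
rewrite in_itv /= => /andP[/ltW c0 /ltW ct].
have ctt : 0 <= c <= t by rewrite c0.
rewrite /second_difference.
have -> : f (t *: u + (t *: v + x)) - f (t *: u + x) - (f (t *: v + x) - f x) = phi t - phi 0.
  by rewrite /phi !scale0r !add0r.
have dd1 : d <= d1 by rewrite ge_min lexx.
pose pu : R := 'd g x u; pose pv : R := 'd g x v.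
have D1 : `|(g (c *: u + (t *: v + x)) : R) - g x - (c * pu + t * pv)| <=
    e' * `|c *: u + t *: v|.
  have := Hd1 _ (lt_le_trans (small _ _ ctt tt) dd1).
  have -> : 'd g x (c *: u + t *: v) = c * pu + t * pv by rewrite linearD !linearZ.
  by rewrite -(addrA (c *: u)).
have D2 : `|(g (c *: u + x) : R) - g x - c * pu| <= e' * `|c *: u|.
  have := Hd1 _ (lt_le_trans (small _ _ ctt zt) dd1).
  have -> : 'd g x (c *: u + 0 *: v) = c * pu by rewrite scale0r addr0 linearZ.
  by rewrite scale0r addr0.
have -> : phi t - phi 0 - t ^+ 2 * 'D_v g x =
    t * ((g (c *: u + (t *: v + x)) - g x - (c * pu + t * pv))
         - (g (c *: u + x) - g x - c * pu)).
  have -> : 'D_v g x = pv by rewrite deriveE.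
  rewrite Ec /dphi scale0r add0r.
  set p : R := g _; set q : R := g _; set o : R := g _; ring.
rewrite normrM gtr0_norm // expr2 mulrCA ler_pM2l //.
apply: le_trans (ler_normB _ _) _.
apply: le_trans (lerD D1 D2) _.
rewrite -mulrDr.
apply: (@le_trans _ _ (e' * (t * (2 * `|u| + `|v|)))).
  rewrite ler_pM2l //; apply: le_trans (lerD (ler_normD _ _) (lexx _)) _.
  rewrite !normrZ (ger0_norm c0) (gtr0_norm t0) mulrDr.
  rewrite addrAC -mulr2n mulr_natl mulrnAr lerD2r lerMn2r /=.
  exact: ler_wpM2r.
rewrite mulrCA [leRHS]mulrC ler_pM2l // /e' -mulrA ger_pMr //.
by rewrite mulrC ler_pdivrMr // mul1r lerDl.
Qed.

(** The second difference is symmetric in [u] and [v], and divided by t^2 it is within e/2 of either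
    mixed derivative. *)
Lemma derive_comm f x u v : (\near x, differentiable f x) ->
  differentiable ('D_u f) x -> differentiable ('D_v f) x ->
  'D_v ('D_u f) x = 'D_u ('D_v f) x.
Proof.
move=> fd ud vd; apply/eqP; rewrite -subr_eq0 -normr_le0.
apply/ler_addgt0Pl => e e0; rewrite addr0.
have e20 : 0 < e / 2 by rewrite divr_gt0.
have [d1 d10 H1] := second_difference_bound v e20 fd ud.
have [d2 d20 H2] := second_difference_bound u e20 fd vd.
pose t := Num.min d1 d2 / 2.
have t0 : 0 < t by rewrite divr_gt0 // lt_min d10.
have tm : t < Num.min d1 d2 by rewrite ltr_pdivrMr // ltr_pMr ?ltr1n // lt_min d10.
move: (H1 t); rewrite t0 (lt_le_trans tm) ?ge_min ?lexx // => /(_ isT) {}H1.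
move: (H2 t); rewrite t0 (lt_le_trans tm) ?ge_min ?lexx ?orbT // => /(_ isT) {}H2.
have E : second_difference f x v u t = second_difference f x u v t.
  by rewrite /second_difference (addrCA (t *: v)); ring.
rewrite E in H2; rewrite -(ler_pM2r (exprn_gt0 2 t0)).
rewrite -[X in _ * X](gtr0_norm (exprn_gt0 2 t0)) -normrM.
move: H1 H2; set S := second_difference f x u v t.
set Lvu : R := 'D_v _ x; set Luv : R := 'D_u _ x => H1 H2.
have -> : (Lvu - Luv) * t ^+ 2 = (S - t ^+ 2 * Luv) - (S - t ^+ 2 * Lvu) by ring.
apply: le_trans (ler_normB _ _) _; apply: le_trans (lerD H2 H1) _.
by rewrite -mulrDl -splitr.
Qed.

End SymmetryOfSecondDerivatives.

(** * Linear and bilinear forms in coordinates *)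

(* Locked, so that [ring] compares forms without unfolding their arguments. *)
HB.lock Definition bf (R : realType) (n : nat) (A : 'M[R]_n) (v w : 'rV[R]_n) : R :=
  \sum_i \sum_j A i j * v 0 i * w 0 j.
HB.lock Definition lf (R : realType) (n : nat) (c v : 'rV[R]_n) : R :=
  \sum_i c 0 i * v 0 i.
HB.lock Definition dmx (R : realType) (n : nat) (A : 'rV[R]_n -> 'M[R]_n) (v x : 'rV[R]_n) :
    'M[R]_n :=
  \matrix_(i, j) 'D_v (fun z => A z i j) x.
HB.lock Definition drow (R : realType) (n : nat) (c : 'rV[R]_n -> 'rV[R]_n) (v x : 'rV[R]_n) :
    'rV[R]_n :=
  \row_i 'D_v (fun z => c z 0 i) x.

Section Forms.
Variables (R : realType) (n : nat).
Local Notation V := 'rV[R]_n.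
Implicit Types (A B M : 'M[R]_n) (c d u v w z y : V) (r : R).
Local Notation e_ k := (delta_mx 0 k : V).

Lemma bfE A v w : bf A v w = (v *m A *m w^T) 0 0.
Proof.
rewrite bf.unlock mxE exchange_big; apply: eq_bigr => j _ /=.
rewrite !mxE big_distrl; apply: eq_bigr => i _ /=; ring.
Qed.

Lemma lfE c v : lf c v = (c *m v^T) 0 0.
Proof. by rewrite lf.unlock mxE; apply: eq_bigr => i _; rewrite mxE. Qed.

Lemma bfDl A u v w : bf A (u + v) w = bf A u w + bf A v w.
Proof. by rewrite !bfE !mulmxDl mxE. Qed.
Lemma bfDr A u v w : bf A w (u + v) = bf A w u + bf A w v.
Proof. by rewrite !bfE linearD mulmxDr mxE. Qed.
Lemma bfZl A r v w : bf A (r *: v) w = r * bf A v w.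
Proof. by rewrite !bfE -!scalemxAl mxE. Qed.
Lemma bfZr A r v w : bf A w (r *: v) = r * bf A w v.
Proof. by rewrite !bfE linearZ -scalemxAr mxE. Qed.
Lemma bfNl A v w : bf A (- v) w = - bf A v w.
Proof. by rewrite -scaleN1r bfZl mulN1r. Qed.
Lemma bfNr A v w : bf A w (- v) = - bf A w v.
Proof. by rewrite -scaleN1r bfZr mulN1r. Qed.
Lemma bf0l A w : bf A 0 w = 0.
Proof. by rewrite -(scale0r 0) bfZl mul0r. Qed.
Lemma bf0r A w : bf A w 0 = 0.
Proof. by rewrite -(scale0r 0) bfZr mul0r. Qed.

Lemma lfD c u v : lf c (u + v) = lf c u + lf c v.
Proof. by rewrite !lfE linearD mulmxDr mxE. Qed.
Lemma lfZ c r v : lf c (r *: v) = r * lf c v.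
Proof. by rewrite !lfE linearZ -scalemxAr mxE. Qed.
Lemma lfN c v : lf c (- v) = - lf c v.
Proof. by rewrite -scaleN1r lfZ mulN1r. Qed.

Definition formE := (bfDl, bfDr, bfZl, bfZr, bfNl, bfNr, lfD, lfZ, lfN).

Lemma bf_lincomb A B r v w : bf (r *: A + B) v w = r * bf A v w + bf B v w.
Proof. by rewrite !bfE mulmxDr mulmxDl -scalemxAr -scalemxAl !mxE. Qed.
Lemma lf_lincomb c d r v : lf (r *: c + d) v = r * lf c v + lf d v.
Proof. by rewrite !lfE mulmxDl -scalemxAl !mxE. Qed.

Lemma bf_delta A i j : bf A (e_ i) (e_ j) = A i j.
Proof.
rewrite bf.unlock (bigD1 i) //= (bigD1 j) //= !mxE !eqxx !mulr1 !big1 ?addr0 //.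
- by move=> k ki; apply: big1 => l _; rewrite !mxE eqxx (negPf ki) mulr0 mul0r.
- by move=> k kj; rewrite !mxE !eqxx (negPf kj) mulr0.
Qed.

Lemma lf_delta c k : lf c (e_ k) = c 0 k.
Proof.
rewrite lf.unlock (bigD1 k) //= !mxE !eqxx !mulr1 !big1 ?addr0 //.
by move=> l lk; rewrite !mxE (negPf lk) mulr0.
Qed.

Lemma bf_tr A v w : bf A^T v w = bf A w v.
Proof.
rewrite bf.unlock exchange_big; apply: eq_bigr => j _; apply: eq_bigr => i _.
by rewrite mxE mulrAC.
Qed.

Lemma bf_sym A v w : A^T = A -> bf A v w = bf A w v.
Proof. by move=> {1}<-; rewrite bf_tr. Qed.

Lemma bf_anti A v w : A^T = - A -> bf A v w = - bf A w v.
Proof.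
move=> AN; rewrite -bf_tr AN bf.unlock -sumrN; apply: eq_bigr => i _.
by rewrite -sumrN; apply: eq_bigr => j _; rewrite mxE !mulNr.
Qed.

(** Turns the index contractions in the definitions of the spray and of the curvature into values of
    linear functions at a vector. *)
Lemma sum_delta (f : V -> R) w :
  (forall r u v, f (r *: u + v) = r * f u + f v) ->
  \sum_m w 0 m * f (e_ m) = f w.
Proof.
move=> fL.
have f0 : f 0 = 0.
  by have := fL 1 0 0; rewrite scale1r addr0 mul1r => /eqP; rewrite -subr_eq subrr => /eqP.
have fS (s : seq 'I_n) : f (\sum_(m <- s) w 0 m *: e_ m) = \sum_(m <- s) w 0 m * f (e_ m).
  by elim: s => [|m s IH]; rewrite ?big_nil // !big_cons fL IH.
by rewrite [in RHS](row_sum_delta w) fS.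
Qed.

Lemma lf_eq c d : (forall v, lf c v = lf d v) -> c = d.
Proof. by move=> cd; apply/rowP => k; rewrite -!lf_delta cd. Qed.

Lemma eq_opp_0 r : r = - r -> r = 0.
Proof. by move=> rN; lra. Qed.

Section Inner.
Variable M : 'M[R]_n.
Hypotheses (Msym : M^T = M) (Mpos : forall v, v != 0 -> 0 < bf M v v).

Lemma bf_ge0 v : 0 <= bf M v v.
Proof. by have [->|/Mpos/ltW//] := eqVneq v 0; rewrite bf0l. Qed.

Lemma bf_eq0 v : (bf M v v == 0) = (v == 0).
Proof.
by have [->|v0] := eqVneq v 0; rewrite ?bf0l ?eqxx // gt_eqF // Mpos.
Qed.

Lemma bf_inj v w : (forall z, bf M v z = bf M w z) -> v = w.
Proof.
move=> vw; apply/eqP; rewrite -subr_eq0 -bf_eq0.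
by rewrite bfDl bfNl vw subrr.
Qed.

(** The square of <w,w> v - <v,w> w equals <w,w> times the difference of the two sides. *)
Lemma bf_CauchySchwarz v w : bf M v w ^+ 2 <= bf M v v * bf M w w.
Proof.
have [->|w0] := eqVneq w 0; first by rewrite !bf0r mulr0 expr0n.
have ww := Mpos w0.
have := bf_ge0 (bf M w w *: v - bf M v w *: w).
have -> : bf M (bf M w w *: v - bf M v w *: w) (bf M w w *: v - bf M v w *: w) =
    bf M w w * (bf M v v * bf M w w - bf M v w ^+ 2).
  by rewrite !formE (bf_sym w v Msym); ring.
by rewrite pmulr_rge0 // subr_ge0.
Qed.

Lemma unitmx_pos : M \in unitmx.
Proof.
apply/negPn/negP; rewrite -row_free_unit -kermx_eq0 => /rowV0Pn [v].
move=> /sub_kermxP vM /Mpos; by rewrite bfE vM mul0mx mxE ltxx.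
Qed.

End Inner.

(** * Derivatives of forms with constant and with variable coefficients *)

Section FormDerivatives.
Implicit Types (x : V).

Lemma is_derive_coord x v k : is_derive x v (fun z : V => z 0 k) (v 0 k).
Proof.
apply: DeriveDef; first exact/diff_derivable/differentiable_coord.
rewrite deriveE; last exact: differentiable_coord.
pose f : V -> R := fun z => z 0 k.
have fL : linear f by move=> r u w; rewrite /f !mxE.
pose fM := GRing.isLinear.Build _ _ _ _ _ fL.
pose g : {linear V -> R} := HB.pack f fM.
rewrite -[fun _ => _]/(g : V -> R) diff_lin //; exact: coord_continuous.
Qed.

Lemma is_derive_lf c y v : is_derive y v (lf c) (lf c v).
Proof.
rewrite lf.unlock; apply: is_derive_sum_pt => i.
have := is_deriveM_pt (is_derive_cst_pt (c 0 i) y v) (is_derive_coord y v i).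
by rewrite mulr0 addr0.
Qed.

Lemma is_derive_bfr A w y v : is_derive y v (bf A w) (bf A w v).
Proof.
rewrite bf.unlock; apply: is_derive_sum_pt => i; apply: is_derive_sum_pt => j.
have := is_deriveM_pt (is_derive_cst_pt (A i j * w 0 i) y v) (is_derive_coord y v j).
by rewrite mulr0 addr0.
Qed.

Lemma is_derive_quad A y v :
  is_derive y v (fun y => bf A y y) (bf A v y + bf A y v).
Proof.
rewrite bf.unlock -big_split; apply: is_derive_sum_pt => i /=.
rewrite -big_split; apply: is_derive_sum_pt => j /=.
have := is_deriveM_pt (is_deriveM_pt (is_derive_cst_pt (A i j) y v)
  (is_derive_coord y v i)) (is_derive_coord y v j).
by rewrite mulr0 addr0 (mulrC (y 0 j)) addrC.
Qed.

Lemma dmxE (A : V -> 'M[R]_n) v x i j : dmx A v x i j = 'D_v (fun z => A z i j) x.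
Proof. by rewrite dmx.unlock mxE. Qed.
Lemma drowE (c : V -> V) v x i : drow c v x 0 i = 'D_v (fun z => c z 0 i) x.
Proof. by rewrite drow.unlock mxE. Qed.

Lemma is_derive_bf_field (A : V -> 'M[R]_n) x v y w :
  (forall i j, differentiable (fun z => A z i j) x) ->
  is_derive x v (fun z => bf (A z) y w) (bf (dmx A v x) y w).
Proof.
move=> Ad; rewrite bf.unlock; apply: is_derive_sum_pt => i; apply: is_derive_sum_pt => j.
have AD := derivableP (diff_derivable (v := v) (Ad i j)).
have := is_deriveM_pt (is_deriveM_pt AD (is_derive_cst_pt (y 0 i) x v))
  (is_derive_cst_pt (w 0 j) x v).
rewrite !mulr0 !add0r ?dmxE ?drowE; congr (is_derive _ _ _ _); ring.
Qed.

Lemma is_derive_lf_field (c : V -> V) x v y :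
  (forall i, differentiable (fun z => c z 0 i) x) ->
  is_derive x v (fun z => lf (c z) y) (lf (drow c v x) y).
Proof.
move=> cd; rewrite lf.unlock; apply: is_derive_sum_pt => i.
have cD := derivableP (diff_derivable (v := v) (cd i)).
have := is_deriveM_pt cD (is_derive_cst_pt (y 0 i) x v).
rewrite !mulr0 !add0r ?dmxE ?drowE; congr (is_derive _ _ _ _); ring.
Qed.

Lemma is_derive_bf_product (A : V -> 'M[R]_n) (c : V -> V) x v w :
  (forall i j, differentiable (fun z => A z i j) x) ->
  (forall i, differentiable (fun z => c z 0 i) x) ->
  is_derive x v (fun z => bf (A z) (c z) w)
    (bf (dmx A v x) (c x) w + bf (A x) (drow c v x) w).
Proof.
move=> Ad cd; rewrite bf.unlock -big_split /=; apply: is_derive_sum_pt => i.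
rewrite -big_split /=; apply: is_derive_sum_pt => j.
have AD := derivableP (diff_derivable (v := v) (Ad i j)).
have cD := derivableP (diff_derivable (v := v) (cd i)).
have := is_deriveM_pt (is_deriveM_pt AD cD) (is_derive_cst_pt (w 0 j) x v).
rewrite !mulr0 !add0r dmxE drowE; congr (is_derive _ _ _ _); ring.
Qed.

Lemma is_derive_lf_product (c d : V -> V) x v :
  (forall i, differentiable (fun z => c z 0 i) x) ->
  (forall i, differentiable (fun z => d z 0 i) x) ->
  is_derive x v (fun z => lf (c z) (d z))
    (lf (drow c v x) (d x) + lf (c x) (drow d v x)).
Proof.
move=> cd dd; rewrite lf.unlock -big_split /=; apply: is_derive_sum_pt => i.
have cD := derivableP (diff_derivable (v := v) (cd i)).
have dD := derivableP (diff_derivable (v := v) (dd i)).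
have := is_deriveM_pt cD dD.
rewrite !drowE; congr (is_derive _ _ _ _); ring.
Qed.

Lemma dmx_comb (A : V -> 'M[R]_n) x r u v :
  (forall i j, differentiable (fun z => A z i j) x) ->
  dmx A (r *: u + v) x = r *: dmx A u x + dmx A v x.
Proof. by move=> Ad; apply/matrixP => i j; rewrite 2!mxE !dmxE derive_comb. Qed.

Lemma drow_comb (c : V -> V) x r u v :
  (forall i, differentiable (fun z => c z 0 i) x) ->
  drow c (r *: u + v) x = r *: drow c u x + drow c v x.
Proof. by move=> cd; apply/rowP => i; rewrite 2!mxE !drowE derive_comb. Qed.

End FormDerivatives.
End Forms.

(** * Directional derivatives of smooth functions on an open set *)

Section SmoothFunctions.
Variables (R : realType) (n : nat) (U : set 'rV[R]_n).
Hypothesis Uopen : open U.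
Local Notation V := 'rV[R]_n.
Local Notation e_ k := (delta_mx 0 k : V).
Implicit Types (f : V -> R) (x u v : V).

Lemma near_open x : U x -> \forall z \near x, U z.
Proof. by move=> Ux; exact: open_nbhs_nbhs. Qed.

Lemma smooth_differentiable f x : smooth_on U f -> U x -> differentiable f x.
Proof. by move=> /(_ [::]); apply. Qed.

Lemma smooth_partial k f : smooth_on U f -> smooth_on U (partial k f).
Proof. by move=> fs s x; have := fs (rcons s k) x; rewrite foldr_rcons. Qed.

Lemma derive_partial f x v : smooth_on U f -> U x ->
  'D_v f x = \sum_k v 0 k * partial k f x.
Proof.
move=> fs Ux; rewrite /partial (sum_delta (f := fun v => 'D_v f x)) // => r w z.
by rewrite derive_comb //; exact: smooth_differentiable.
Qed.

(** [smooth_on] speaks of iterated partial derivatives only; near [x] a directional derivative is a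
    combination of these with constant coefficients. *)
Lemma differentiable_derive f x v : smooth_on U f -> U x ->
  differentiable ('D_v f) x.
Proof.
move=> fs Ux.
apply: (@near_eq_differentiable _ _ (fun z => \sum_k v 0 k * partial k f z)).
  by near=> z; rewrite derive_partial //; near: z; exact: near_open.
apply: differentiable_sum_pt => k; apply: differentiableMl_pt.
by apply: smooth_differentiable => //; exact: smooth_partial.
Unshelve. all: by end_near. Qed.

Lemma smooth_derive_comm f x u v : smooth_on U f -> U x ->
  'D_v ('D_u f) x = 'D_u ('D_v f) x.
Proof.
move=> fs Ux; apply: derive_comm; try exact: differentiable_derive.
near=> z; apply: smooth_differentiable => //; near: z; exact: near_open.
Unshelve. all: by end_near. Qed.

End SmoothFunctions.

Section LinearExtension.
Variables (R : realType) (n : nat).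
Local Notation V := 'rV[R]_n.
Local Notation e_ k := (delta_mx 0 k : V).
Implicit Types (f g : V -> R).

(** Carries an identity between components over to arbitrary vectors, one argument at a time. *)
Lemma linear_ext f g :
  (forall r u v, f (r *: u + v) = r * f u + f v) ->
  (forall r u v, g (r *: u + v) = r * g u + g v) ->
  (forall k, f (e_ k) = g (e_ k)) -> f =1 g.
Proof.
move=> fL gL fg v; rewrite -(sum_delta v fL) -(sum_delta v gL).
by apply: eq_bigr => k _; rewrite fg.
Qed.

End LinearExtension.

(** * Covariant derivatives and curvature in one chart *)

(** The assumptions of the theorem as seen on the image [U] of one chart. Nonvanishing of beta and
    the flag curvature condition are left out: they are imposed later, at a single point. *)
Record killing_chart (R : realType) (n : nat) (U : set 'rV[R]_n)
    (a : 'rV[R]_n -> 'M[R]_n) (b : 'rV[R]_n -> 'rV[R]_n) : Prop := {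
  kc_open : open U;
  kc_metric_smooth : forall i j, smooth_on U (fun x => a x i j);
  kc_form_smooth : forall k, smooth_on U (fun x => b x 0 k);
  kc_sym : forall x, U x -> (a x)^T = a x;
  kc_pos : forall x, U x -> forall y, y != 0 -> 0 < bf (a x) y y;
  kc_norm : forall x, U x -> beta_norm a b x < 1;
  kc_killing : forall x, U x -> killing_at a b x
}.

Section LocalGeometry.
Variables (R : realType) (n : nat) (U : set 'rV[R]_n).
Variables (a : 'rV[R]_n -> 'M[R]_n) (b : 'rV[R]_n -> 'rV[R]_n).
Local Notation V := 'rV[R]_n.
Local Notation e_ k := (delta_mx 0 k : V).
Local Notation F := (randers a b).
Local Notation al := (alpha a).
Hypothesis L : killing_chart U a b.
Implicit Types (x y u v w z : V) (i j k l : 'I_n).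

(* [Gam x v w] is Gamma^i_jk v^j w^k, [sharp x v] is s^i_j v^j. *)
Definition gam x i : 'M[R]_n := \matrix_(j, k) christoffel a i j k x.
Definition Gam x v w : V := \row_i bf (gam x i) v w.
Definition smat x : 'M[R]_n := \matrix_(i, j) s_low a b i j x.
Definition smix x : 'M[R]_n := \matrix_(i, j) s_mixed a b i j x.
Definition sharp x v : V := v *m (smix x)^T.
Definition bvec x : V := \row_i b_up a b i x.

Let Uopen := kc_open L.
Let asmooth := kc_metric_smooth L.
Let bsmooth := kc_form_smooth L.
Let asym := kc_sym L.
Let apos := kc_pos L.
Let bkill := kc_killing L.

Let aunit x : U x -> a x \in unitmx.
Proof. by move=> Ux; apply: unitmx_pos; exact: apos. Qed.

Let ad x : U x -> forall i j, differentiable (fun z => a z i j) x.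
Proof. by move=> Ux i j; apply: smooth_differentiable Ux. Qed.

Let bd x : U x -> forall k, differentiable (fun z => b z 0 k) x.
Proof. by move=> Ux k; apply: smooth_differentiable Ux. Qed.

Lemma differentiable_inv_metric x i j : U x ->
  differentiable (fun z => inv_metric a z i j) x.
Proof.
move=> Ux; apply: differentiable_invmx; first exact: ad.
near=> z; apply: aunit; near: z; exact: near_open.
Unshelve. all: by end_near. Qed.

Let da x i j k : U x -> differentiable (partial k (fun z => a z i j)) x.
Proof. by move=> Ux; apply: smooth_differentiable Ux; exact: smooth_partial. Qed.

Lemma differentiable_gam x i j k : U x ->
  differentiable (fun z => gam z i j k) x.
Proof.
move=> Ux; rewrite (_ : (fun _ => _) = christoffel a i j k); last first.
  by apply/funext => z; rewrite mxE.
apply: differentiableMl_pt; apply: differentiable_sum_pt => l.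
apply: differentiableM_pt; first exact: differentiable_inv_metric.
by apply: differentiableB_pt; [apply: differentiableD_pt|]; exact: da.
Qed.

Let db x j k : U x -> differentiable (partial k (fun z => b z 0 j)) x.
Proof. by move=> Ux; apply: smooth_differentiable Ux; exact: smooth_partial. Qed.

Lemma differentiable_smat x i j : U x -> differentiable (fun z => smat z i j) x.
Proof.
move=> Ux; rewrite (_ : (fun _ => _) = s_low a b i j); last first.
  by apply/funext => z; rewrite mxE.
have cd k l : differentiable (cov_deriv a b k l) x.
  apply: differentiableB_pt; first exact: db.
  apply: differentiable_sum_pt => m; apply: differentiableM_pt; last exact: bd.
  have <- : (fun z => gam z m k l) = christoffel a m k l.
    by apply/funext => z; rewrite mxE.
  exact: differentiable_gam.
by apply: differentiableMl_pt; apply: differentiableB_pt.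
Qed.

Lemma differentiable_smix x i j : U x -> differentiable (fun z => smix z i j) x.
Proof.
move=> Ux; rewrite (_ : (fun _ => _) =
  (fun z => \sum_k inv_metric a z i k * smat z k j)); last first.
  by apply/funext => z; rewrite !mxE; apply: eq_bigr => k _; rewrite !mxE.
apply: differentiable_sum_pt => k; apply: differentiableM_pt.
  exact: differentiable_inv_metric.
exact: differentiable_smat.
Qed.

Lemma Gam_comb_l x r u v w : Gam x (r *: u + v) w = r *: Gam x u w + Gam x v w.
Proof. by apply/rowP => i; rewrite !mxE !formE. Qed.
Lemma Gam_comb_r x r u v w : Gam x w (r *: u + v) = r *: Gam x w u + Gam x w v.
Proof. by apply/rowP => i; rewrite !mxE !formE. Qed.

Let invT x : U x -> (inv_metric a x)^T = inv_metric a x.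
Proof. by move=> Ux; rewrite /inv_metric trmx_inv asym. Qed.

(** The Christoffel symbols of the first kind as a trilinear form; trilinearity lets [bf_Gam] be
    checked on basis vectors. *)
Let lowGam x v w z : R :=
  2^-1 * (bf (dmx a v x) w z + bf (dmx a w x) v z - bf (dmx a z x) v w).

Let lowGam_comb1 x r u v w z : U x ->
  lowGam x (r *: u + v) w z = r * lowGam x u w z + lowGam x v w z.
Proof.
move=> Ux; rewrite /lowGam dmx_comb; last exact: ad.
by rewrite bf_lincomb !formE; ring.
Qed.

Let lowGam_comb2 x r u v w z : U x ->
  lowGam x w (r *: u + v) z = r * lowGam x w u z + lowGam x w v z.
Proof.
move=> Ux; rewrite /lowGam dmx_comb; last exact: ad.
by rewrite bf_lincomb !formE; ring.
Qed.

Let lowGam_comb3 x r u v w z : U x ->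
  lowGam x w z (r *: u + v) = r * lowGam x w z u + lowGam x w z v.
Proof.
move=> Ux; rewrite /lowGam dmx_comb; last exact: ad.
by rewrite bf_lincomb !formE; ring.
Qed.

Lemma bf_Gam x v w z : U x -> bf (a x) (Gam x v w) z =
  2^-1 * (bf (dmx a v x) w z + bf (dmx a w x) v z - bf (dmx a z x) v w).
Proof.
move=> Ux; rewrite -/(lowGam x v w z).
move: z; apply: linear_ext => [r u z|r u z|l].
- by rewrite !formE.
- exact: lowGam_comb3.
move: w; apply: linear_ext => [r u w|r u w|k].
- by rewrite Gam_comb_r bfDl bfZl.
- exact: lowGam_comb2.
move: v; apply: linear_ext => [r u v|r u v|j].
- by rewrite Gam_comb_l bfDl bfZl.
- exact: lowGam_comb1.
rewrite /lowGam !bf_delta !dmxE bfE.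
pose C : V := \row_l (partial j (fun z => a z k l) x + partial k (fun z => a z j l) x
     - partial l (fun z => a z j k) x).
have -> : Gam x (e_ j) (e_ k) = 2^-1 *: (C *m (inv_metric a x)^T).
  apply/rowP => i; rewrite !mxE bf_delta mxE; congr (_ * _).
  by apply: eq_bigr => m _; rewrite !mxE mulrC.
rewrite invT // -scalemxAl -(mulmxA C) mulVmx ?aunit // mulmx1 -lfE lf_delta.
by rewrite !mxE.
Qed.

Let near_asym x : U x -> \forall z \near x, (a z)^T = a z.
Proof.
by move=> Ux; near=> z; apply: asym; near: z; exact: near_open.
Unshelve. all: by end_near. Qed.

Lemma dmx_sym v x : U x -> (dmx a v x)^T = dmx a v x.
Proof.
move=> Ux; apply/matrixP => i j; rewrite mxE !dmxE; apply: near_eq_derive.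
by apply: filterS (near_asym Ux) => z az; rewrite -[in LHS]az mxE.
Qed.

Lemma GamC x v w : U x -> Gam x v w = Gam x w v.
Proof.
move=> Ux; apply: (bf_inj (apos Ux)) => z; rewrite !bf_Gam //.
by rewrite (bf_sym v w (dmx_sym z Ux)) (addrC (bf _ w z)).
Qed.

(** Compatibility of the Levi-Civita connection with the metric. It is used to express all first
    derivatives of [a] through [Gam]. *)
Lemma bf_dmx x v w z : U x ->
  bf (dmx a v x) w z = bf (a x) (Gam x v w) z + bf (a x) (Gam x v z) w.
Proof.
move=> Ux; rewrite !bf_Gam // (bf_sym z w (dmx_sym v Ux)).
by rewrite (bf_sym v z (dmx_sym w Ux)) (bf_sym v w (dmx_sym z Ux)); field.
Qed.

Lemma smat_anti x : (smat x)^T = - smat x.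
Proof. by apply/matrixP => i j; rewrite !mxE -mulrN opprB. Qed.

Lemma smix_E x : smix x = inv_metric a x *m smat x.
Proof. by apply/matrixP => i j; rewrite !mxE; apply: eq_bigr => k _; rewrite mxE. Qed.

Lemma bf_sharp x v z : U x -> bf (a x) (sharp x v) z = bf (smat x) z v.
Proof.
move=> Ux; rewrite bfE /sharp smix_E trmx_mul invT // -!mulmxA (mulmxA (inv_metric a x)).
by rewrite mulVmx ?aunit // mul1mx mulmxA -bfE bf_tr.
Qed.

(** The Killing equation annihilates the symmetric part of the covariant derivative of b; every use
    of that equation goes through this identity. *)
Lemma cov_derivE x i j : U x -> cov_deriv a b i j x = s_low a b i j x.
Proof.
move=> Ux; have := bkill Ux i j; rewrite /s_low.
set p := cov_deriv _ _ i j x; set q := cov_deriv _ _ j i x.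
by move/eqP; rewrite addr_eq0 => /eqP ->; field.
Qed.

Lemma lf_drow x v w : U x ->
  lf (drow b v x) w = lf (b x) (Gam x v w) + bf (smat x) w v.
Proof.
move=> Ux; move: w; apply: linear_ext => [r u w|r u w|i].
- by rewrite !formE.
- by rewrite Gam_comb_r !formE; ring.
move: v; apply: linear_ext => [r u v|r u v|j].
- rewrite drow_comb; last exact: bd.
  by rewrite lf_lincomb.
- by rewrite Gam_comb_l !formE; ring.
rewrite lf_delta bf_delta drowE mxE -cov_derivE // /cov_deriv GamC //.
rewrite addrC -[LHS](subrK (lf (b x) (Gam x (e_ i) (e_ j)))); congr (_ - _ + _).
by rewrite lf.unlock; apply: eq_bigr => k _; rewrite mxE bf_delta mxE mulrC.
Qed.

Lemma lf_bvec x z : U x -> bf (a x) (bvec x) z = lf (b x) z.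
Proof.
move=> Ux; have -> : bvec x = b x *m (inv_metric a x)^T.
  by apply/rowP => i; rewrite !mxE; apply: eq_bigr => j _; rewrite !mxE mulrC.
by rewrite bfE invT // -(mulmxA (b x)) mulVmx ?aunit // mulmx1 -lfE.
Qed.

Lemma beta_normE x : U x -> beta_norm a b x ^+ 2 = bf (a x) (bvec x) (bvec x).
Proof.
move=> Ux; have E : \sum_i \sum_j inv_metric a x i j * b x 0 i * b x 0 j =
    bf (a x) (bvec x) (bvec x).
  rewrite lf_bvec // lf.unlock; apply: eq_bigr => i _; rewrite !mxE big_distrr.
  by apply: eq_bigr => j _ /=; rewrite -mulrA mulrCA.
by rewrite /beta_norm E sqr_sqrtr //; apply: bf_ge0; exact: apos.
Qed.

Lemma sharp_comb x r u v : sharp x (r *: u + v) = r *: sharp x u + sharp x v.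
Proof. by rewrite /sharp mulmxDl scalemxAl. Qed.

(** By definition t(z) = s(b, s#z), which is <s#(s#z), b>; the sign comes from moving the outer s#
    to b. *)
Lemma lf_t_vec x z : U x ->
  lf (\row_i t_vec a b i x) z = - bf (a x) (sharp x (bvec x)) (sharp x z).
Proof.
move=> Ux; rewrite bf_sharp // (bf_anti _ _ (smat_anti x)) opprK lfE bfE /sharp.
rewrite trmx_mul trmxK !mulmxA; congr ((_ *m _) 0 0).
rewrite -mulmxA; apply/rowP => i; rewrite !mxE; apply: eq_bigr => j _.
by rewrite !mxE; congr (_ * _); apply: eq_bigr => k _; rewrite !mxE.
Qed.

Lemma t0E x y : U x -> t0 a b x y = - bf (a x) (sharp x (bvec x)) (sharp x y).
Proof.
by move=> Ux; rewrite -lf_t_vec // /t0 lf.unlock; apply: eq_bigr => i _; rewrite mxE.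
Qed.

Definition dGam u x v w : V := \row_i bf (dmx (gam^~ i) u x) v w.
Definition dsharp u x v : V := v *m (dmx smix u x)^T.
(* The curvature operator R(u, v)w. *)
Definition curv x u v w : V :=
  dGam u x v w - dGam v x u w + Gam x u (Gam x v w) - Gam x v (Gam x u w).
(* The derivative s_ij|k w^i v^j u^k. *)
Definition nabla_s x u v w : R :=
  bf (a x) (dsharp u x v + Gam x u (sharp x v) - sharp x (Gam x u v)) w.

Lemma differentiable_Gam x v w i : U x ->
  differentiable (fun q => Gam q v w 0 i) x.
Proof.
move=> Ux; rewrite (_ : (fun _ => _) =
  fun q => \sum_j \sum_k gam q i j k * v 0 j * w 0 k); last first.
  by apply/funext => q; rewrite mxE bf.unlock.
apply: differentiable_sum_pt => j; apply: differentiable_sum_pt => k.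
apply: differentiableM_pt; last exact: differentiable_cst.
apply: differentiableM_pt; last exact: differentiable_cst.
exact: differentiable_gam.
Qed.

Lemma drow_Gam x u v w : U x -> drow (fun q => Gam q v w) u x = dGam u x v w.
Proof.
move=> Ux; apply/rowP => i; rewrite drowE mxE.
have D : is_derive x u (fun q => bf (gam q i) v w) (bf (dmx (gam^~ i) u x) v w).
  by apply: is_derive_bf_field => j k; exact: differentiable_gam.
rewrite -(derive_val (is_derive := D)); congr ('D_u _ x).
by apply/funext => q; rewrite mxE.
Qed.

Let sharpE q v i : sharp q v 0 i = \sum_j v 0 j * smix q i j.
Proof. by rewrite mxE; apply: eq_bigr => j _; rewrite mxE. Qed.

Lemma differentiable_sharp x v i : U x ->
  differentiable (fun q => sharp q v 0 i) x.
Proof.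
move=> Ux; rewrite (funext (fun q => sharpE q v i)).
apply: differentiable_sum_pt => j; apply: differentiableMl_pt.
exact: differentiable_smix.
Qed.

Lemma drow_sharp x u v : U x -> drow (fun q => sharp q v) u x = dsharp u x v.
Proof.
move=> Ux; apply/rowP => i; rewrite drowE mxE.
rewrite (funext (fun q => sharpE q v i)).
have D : is_derive x u (fun q => \sum_j v 0 j * smix q i j)
    (\sum_j (v 0 j * 'D_u (fun q => smix q i j) x + smix x i j * 0)).
  apply: is_derive_sum_pt => j.
  have D := derivableP (diff_derivable (v := u) (differentiable_smix i j Ux)).
  exact: is_deriveM_pt (is_derive_cst_pt (v 0 j) x u) D.
by rewrite derive_val; apply: eq_bigr => j _; rewrite mulr0 addr0 mxE dmxE.
Qed.

Let derive_U (f g : V -> R) x u : U x -> (forall z, U z -> f z = g z) -> 'D_u f x = 'D_u g x.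
Proof.
move=> Ux fg; apply: near_eq_derive.
by near=> z; apply: fg; near: z; exact: near_open.
Unshelve. all: by end_near. Qed.

Let ddmx x u v : 'M[R]_n := dmx (dmx a v) u x.

Let dad x v i j : U x -> differentiable (fun z => dmx a v z i j) x.
Proof.
move=> Ux; rewrite (_ : (fun _ => _) = 'D_v (fun z => a z i j)).
  exact: differentiable_derive Ux.
by apply/funext => z; rewrite dmxE.
Qed.

Let ddmxC x u v : U x -> ddmx x u v = ddmx x v u.
Proof.
move=> Ux; apply/matrixP => i j; rewrite /ddmx !dmxE.
have E w : (fun z => dmx a w z i j) = 'D_w (fun z => a z i j).
  by apply/funext => z; rewrite dmxE.
by rewrite !E; exact: smooth_derive_comm Ux.
Qed.

Let ddmx_sym x u v : U x -> (ddmx x u v)^T = ddmx x u v.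
Proof.
move=> Ux; apply/matrixP => i j; rewrite mxE /ddmx !dmxE.
by apply: derive_U => // z Uz; rewrite -[in LHS]dmx_sym // mxE.
Qed.

(** Differentiation of [bf_Gam] along [u]; the two products of [Gam] come from the derivative of [a]
    on the left-hand side. *)
Lemma bf_dGam x u v w z : U x -> bf (a x) (dGam u x v w) z =
  2^-1 * (bf (ddmx x u v) w z + bf (ddmx x u w) v z - bf (ddmx x u z) v w)
  - bf (a x) (Gam x u (Gam x v w)) z - bf (a x) (Gam x u z) (Gam x v w).
Proof.
move=> Ux; have D1 := is_derive_bf_product u z (ad Ux)
  (fun i => differentiable_Gam v w i Ux).
have Dd p q r := is_derive_bf_field u q r (fun i j => dad p i j Ux).
have D2 := is_deriveM_pt (is_derive_cst_pt (2^-1 : R) x u)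
  (is_deriveB_pt (is_deriveD_pt (Dd v w z) (Dd w v z)) (Dd z v w)).
have := derive_U u Ux (fun q => @bf_Gam q v w z).
rewrite (derive_val (is_derive := D1)) (derive_val (is_derive := D2)).
rewrite drow_Gam // bf_dmx // /ddmx mulr0 addr0 => <-; ring.
Qed.

(** The classical expression of the curvature tensor by second derivatives of the metric and
    products of Christoffel symbols. The symmetries below are read off from it, since second
    derivatives commute. *)
Lemma curvE x u v w z : U x -> bf (a x) (curv x u v w) z =
  2^-1 * (bf (ddmx x u w) v z - bf (ddmx x u z) v w
          - bf (ddmx x v w) u z + bf (ddmx x v z) u w)
  - bf (a x) (Gam x u z) (Gam x v w) + bf (a x) (Gam x v z) (Gam x u w).
Proof.
move=> Ux; rewrite /curv !formE !bf_dGam // (ddmxC v u Ux).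
by set p := bf (ddmx x u v) w z; field.
Qed.

Lemma curv_pair x u v w z : U x ->
  bf (a x) (curv x u v w) z = bf (a x) (curv x w z u) v.
Proof.
move=> Ux; rewrite !curvE // (ddmxC w u Ux) (ddmxC w v Ux) (ddmxC z u Ux) (ddmxC z v Ux).
rewrite (bf_sym z v (ddmx_sym u w Ux)) (bf_sym z u (ddmx_sym v w Ux)).
rewrite (bf_sym w v (ddmx_sym u z Ux)) (bf_sym w u (ddmx_sym v z Ux)).
rewrite (GamC w v Ux) (GamC z u Ux) (GamC z v Ux) (GamC w u Ux).
by rewrite (bf_sym (Gam x v w) _ (asym Ux)); ring.
Qed.

Lemma curv_antiC x u v w : curv x v u w = - curv x u v w.
Proof. by apply/rowP => i; rewrite /curv !mxE; ring. Qed.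

Lemma curv_anti x u v w z : U x ->
  bf (a x) (curv x u v w) z = - bf (a x) (curv x u v z) w.
Proof.
move=> Ux; rewrite curv_pair // curv_antiC bfNl; congr (- _).
by rewrite curv_pair.
Qed.

Lemma nabla_sE x u v w : U x -> nabla_s x u v w =
  bf (dmx smat u x) w v - bf (smat x) (Gam x u w) v - bf (smat x) w (Gam x u v).
Proof.
move=> Ux; have D1 := is_derive_bf_product u w (ad Ux)
  (fun i => differentiable_sharp v i Ux).
have D2 := is_derive_bf_field u w v (fun i j => differentiable_smat i j Ux).
have := derive_U u Ux (fun q => @bf_sharp q v w).
rewrite (derive_val (is_derive := D1)) (derive_val (is_derive := D2)).
rewrite drow_sharp // bf_dmx // /nabla_s !formE => <-.
rewrite -(bf_sharp (Gam x u v)) // (bf_sym (Gam x u w) _ (asym Ux)) -?bf_sharp //.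
by rewrite (bf_sym (sharp x v) (Gam _ _ _) (asym Ux)); ring.
Qed.

Let dsmat_anti x u : U x -> (dmx smat u x)^T = - dmx smat u x.
Proof.
move=> Ux; apply/matrixP => i j; rewrite !mxE !dmxE.
have D := derivableP (diff_derivable (v := u) (differentiable_smat i j Ux)).
rewrite -(derive_val (is_derive := is_deriveN_pt D)); congr ('D_u _ x).
by apply/funext => z; have := smat_anti z => /matrixP /(_ i j); rewrite !mxE.
Qed.

Lemma nabla_s_anti x u v w : U x -> nabla_s x u v w = - nabla_s x u w v.
Proof.
move=> Ux; rewrite !nabla_sE // (bf_anti w v (dsmat_anti u Ux)).
by rewrite (bf_anti (Gam x u w) v (smat_anti x)) (bf_anti w (Gam x u v) (smat_anti x)); ring.
Qed.

(** The Ricci identity for b, whose covariant derivative is s. For constant [w], the derivatives of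
    b(w) along [u] and [v] commute; both orders are computed in [H] by differentiating [lf_drow],
    and their difference is the claim. *)
Lemma ricci_b x u v w : U x ->
  nabla_s x v u w - nabla_s x u v w = lf (b x) (curv x u v w).
Proof.
move=> Ux.
have H p q : 'D_p ('D_q (fun z => lf (b z) w)) x =
    lf (b x) (Gam x p (Gam x q w)) + bf (smat x) (Gam x q w) p
    + lf (b x) (dGam p x q w) + bf (dmx smat p x) w q.
  have -> : 'D_p ('D_q (fun z => lf (b z) w)) x =
      'D_p (fun z => lf (b z) (Gam z q w) + bf (smat z) w q) x.
    apply: derive_U => // z Uz; rewrite -lf_drow //.
    have D := is_derive_lf_field q w (bd Uz).
    by rewrite derive_val.
  have D1 := is_derive_lf_product p (bd Ux) (fun i => differentiable_Gam q w i Ux).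
  have D2 := is_derive_bf_field p w q (fun i j => differentiable_smat i j Ux).
  have D := is_deriveD_pt D1 D2.
  by rewrite (derive_val (is_derive := D)) drow_Gam // lf_drow //; ring.
have fd z : U z -> differentiable (fun q => lf (b q) w) z.
  move=> Uz; rewrite lf.unlock; apply: differentiable_sum_pt => i.
  by apply: differentiableM_pt; [exact: bd|exact: differentiable_cst].
have dd q : differentiable ('D_q (fun z => lf (b z) w)) x.
  apply: (@near_eq_differentiable _ _
    (fun z => \sum_i 'D_q (fun y => b y 0 i) z * w 0 i)).
    near=> z; have Uz : U z by near: z; exact: near_open.
    have D := is_derive_lf_field q w (bd Uz).
    rewrite (derive_val (is_derive := D)) lf.unlock.
    by apply: eq_bigr => i _; rewrite drowE.
  apply: differentiable_sum_pt => i; apply: differentiableM_pt.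
    exact: differentiable_derive Ux.
  exact: differentiable_cst.
have fn : \forall z \near x, differentiable (fun q => lf (b q) w) z.
  by near=> z; apply: fd; near: z; exact: near_open.
have := derive_comm fn (dd u) (dd v).
rewrite !H !nabla_sE // /curv !formE (GamC v u Ux).
rewrite (bf_anti (Gam x u w) v (smat_anti x)) (bf_anti (Gam x v w) u (smat_anti x)) => E.
lra.
Unshelve. all: by end_near. Qed.

(** A case of Kostant's formula for Killing fields: with [u] repeated, the term [nabla_s x y u u] of
    the Ricci identity is zero by skew-symmetry. *)
Lemma killing_nabla_s x u y : U x ->
  nabla_s x u y u = - lf (b x) (curv x u y u).
Proof.
move=> Ux; have := ricci_b u y u Ux.
by rewrite (eq_opp_0 (nabla_s_anti y u u Ux)) sub0r => <-; rewrite opprK.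
Qed.

(** * The fundamental tensor and the spray of the Randers metric *)

Lemma alphaE x y : al x y = Num.sqrt (bf (a x) y y).
Proof. by rewrite bf.unlock. Qed.

Lemma randersE x y : F x y = al x y + lf (b x) y.
Proof. by rewrite lf.unlock. Qed.

Lemma alpha_gt0 x y : U x -> y != 0 -> 0 < al x y.
Proof. by move=> Ux y0; rewrite alphaE sqrtr_gt0; exact: apos. Qed.

Lemma alpha_sqr x y : U x -> al x y ^+ 2 = bf (a x) y y.
Proof. by move=> Ux; rewrite alphaE sqr_sqrtr //; apply: bf_ge0; exact: apos. Qed.

Lemma alphaN x y : al x (- y) = al x y.
Proof. by rewrite !alphaE bfNl bfNr opprK. Qed.

(** By Cauchy-Schwarz, |beta| is at most the norm of b times alpha, and this norm is below 1. *)
Lemma randers_gt0 x y : U x -> y != 0 -> 0 < F x y.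
Proof.
move=> Ux y0; have al0 := alpha_gt0 Ux y0; rewrite randersE.
have b1 : bf (a x) (bvec x) (bvec x) < 1.
  rewrite -(beta_normE Ux) expr_lt1 //; last by rewrite sqrtr_ge0.
  exact: (kc_norm L).
have := bf_CauchySchwarz (asym Ux) (apos Ux) (bvec x) y.
rewrite lf_bvec // -(alpha_sqr y Ux) => CS.
have : lf (b x) y ^+ 2 < al x y ^+ 2.
  by apply: le_lt_trans CS _; rewrite gtr_pMl // exprn_gt0.
rewrite -ltr_sqrt ?exprn_gt0 // !sqrtr_sqr (gtr0_norm al0) ltr_norml => /andP[+ _].
by rewrite -subr_gt0 opprK addrC.
Qed.

Lemma alpha_neq0 x y : U x -> y != 0 -> al x y != 0.
Proof. by move=> Ux y0; exact: lt0r_neq0 (alpha_gt0 Ux y0). Qed.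

Lemma randers_neq0 x y : U x -> y != 0 -> F x y != 0.
Proof. by move=> Ux y0; exact: lt0r_neq0 (randers_gt0 Ux y0). Qed.

Lemma is_derive_alpha_y x y w : U x -> y != 0 ->
  is_derive y w (al x) (bf (a x) w y / al x y).
Proof.
move=> Ux y0; have al0 := alpha_gt0 Ux y0.
rewrite (funext (alphaE x)).
have := is_derive_sqrt_pt (apos Ux y0) (is_derive_quad (a x) y w).
rewrite -alphaE (bf_sym y w (asym Ux)); congr (is_derive _ _ _ _).
by field; rewrite gt_eqF.
Qed.

Lemma is_derive_alpha_x x y v : U x -> y != 0 ->
  is_derive x v (fun z => al z y) (bf (dmx a v x) y y / (2 * al x y)).
Proof.
move=> Ux y0; rewrite (funext (fun z => alphaE z y)) alphaE.
exact: is_derive_sqrt_pt (apos Ux y0) (is_derive_bf_field v y y (ad Ux)).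
Qed.

Definition Fy x y w : R := bf (a x) w y / al x y + lf (b x) w.
(** Also the y-Hessian of [F], because beta is linear in y. *)
Definition hess_alpha x y w v : R :=
  bf (a x) w v / al x y - bf (a x) w y * bf (a x) v y / al x y ^+ 3.
Definition Fx x y v : R := bf (dmx a v x) y y / (2 * al x y) + lf (drow b v x) y.
Definition Fxy x y v w : R :=
  bf (dmx a v x) w y / al x y - bf (dmx a v x) y y * bf (a x) w y / (2 * al x y ^+ 3)
  + lf (drow b v x) w.
Definition gform x y w v : R := Fy x y w * Fy x y v + F x y * hess_alpha x y w v.

Lemma is_derive_F_y x y w : U x -> y != 0 -> is_derive y w (F x) (Fy x y w).
Proof.
move=> Ux y0; rewrite (funext (randersE x)).
exact: is_deriveD_pt (is_derive_alpha_y w Ux y0) (is_derive_lf (b x) y w).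
Qed.

Lemma is_derive_F_x x y v : U x -> y != 0 -> is_derive x v (fun z => F z y) (Fx x y v).
Proof.
move=> Ux y0; rewrite (funext (fun z => randersE z y)).
exact: is_deriveD_pt (is_derive_alpha_x v Ux y0) (is_derive_lf_field v y (bd Ux)).
Qed.

Lemma is_derive_bfV x y w v (f : V -> R) df : U x -> y != 0 ->
  is_derive y v f df ->
  is_derive y v (fun y => f y / al x y)
    (df / al x y - f y * bf (a x) v y / al x y ^+ 3).
Proof.
move=> Ux y0 fD; have al0 := alpha_gt0 Ux y0; have aln0 := lt0r_neq0 al0.
have := is_deriveM_pt fD (is_deriveV_pt aln0 (is_derive_alpha_y v Ux y0)).
by congr (is_derive _ _ _ _); field.
Qed.

Lemma is_derive_Fy x y w v : U x -> y != 0 ->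
  is_derive y v (fun y => Fy x y w) (hess_alpha x y w v).
Proof.
move=> Ux y0.
have := is_deriveD_pt (is_derive_bfV w Ux y0 (is_derive_bfr (a x) w y v))
  (is_derive_cst_pt (lf (b x) w) y v).
by rewrite addr0.
Qed.

Lemma is_derive_Fx_y x y v w : U x -> y != 0 ->
  is_derive y w (fun y => Fx x y v) (Fxy x y v w).
Proof.
move=> Ux y0; have al0 := alpha_gt0 Ux y0.
have H := is_derive_bfV w Ux y0 (is_derive_quad (dmx a v x) y w).
have := is_deriveD_pt (is_deriveM_pt (is_derive_cst_pt (2^-1 : R) y w) H)
  (is_derive_lf (drow b v x) y w).
rewrite (_ : (fun z => _) = (fun y => Fx x y v)); last first.
  by apply/funext => z; rewrite /Fx; congr (_ + _); rewrite invfM; ring.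
rewrite (bf_sym y w (dmx_sym v Ux)) mulr0 addr0.
by congr (is_derive _ _ _ _); rewrite /Fxy; field; rewrite gt_eqF.
Qed.

Lemma dyF2 i x y : U x -> y != 0 -> dy i (F2 F) x y = 2 * F x y * Fy x y (e_ i).
Proof.
move=> Ux y0; have FD := is_derive_F_y (e_ i) Ux y0.
rewrite /dy /partial /F2 (_ : (fun y => _) = (fun y => F x y * F x y)); last first.
  by apply/funext => z; rewrite expr2.
by rewrite (derive_val (is_derive := is_deriveM_pt FD FD)); ring.
Qed.

Lemma dyyF2 i j x y : U x -> y != 0 ->
  dy j (dy i (F2 F)) x y = 2 * gform x y (e_ i) (e_ j).
Proof.
move=> Ux y0; rewrite /dy /partial -/(dy i (F2 F) x).
rewrite (@near_eq_derive _ _ _ _ (fun y => 2 * F x y * Fy x y (e_ i))); last first.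
  by apply: filterS (near_neq0 y0) => z z0; apply: dyF2.
have D := is_deriveM_pt (is_deriveM_pt (is_derive_cst_pt (2 : R) y (e_ j))
  (is_derive_F_y (e_ j) Ux y0)) (is_derive_Fy (e_ i) (e_ j) Ux y0).
by rewrite (derive_val (is_derive := D)) /gform; ring.
Qed.

Lemma dxF2 k x y : U x -> y != 0 -> dx k (F2 F) x y = 2 * F x y * Fx x y (e_ k).
Proof.
move=> Ux y0; have FD := is_derive_F_x (e_ k) Ux y0.
rewrite /dx /partial /F2 (_ : (fun y => _) = (fun z => F z y * F z y)); last first.
  by apply/funext => z; rewrite expr2.
by rewrite (derive_val (is_derive := is_deriveM_pt FD FD)); ring.
Qed.

Lemma dyxF2 l k x y : U x -> y != 0 -> dy l (dx k (F2 F)) x y =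
  2 * (Fy x y (e_ l) * Fx x y (e_ k) + F x y * Fxy x y (e_ k) (e_ l)).
Proof.
move=> Ux y0; rewrite /dy /partial -/(dy l (F2 F) x).
rewrite (@near_eq_derive _ _ _ _ (fun y => 2 * F x y * Fx x y (e_ k))); last first.
  by apply: filterS (near_neq0 y0) => z z0; apply: dxF2.
have D := is_deriveM_pt (is_deriveM_pt (is_derive_cst_pt (2 : R) y (e_ l))
  (is_derive_F_y (e_ l) Ux y0)) (is_derive_Fx_y (e_ k) (e_ l) Ux y0).
by rewrite (derive_val (is_derive := D)); ring.
Qed.

Lemma gform_comb_l x y r u v w :
  gform x y (r *: u + v) w = r * gform x y u w + gform x y v w.
Proof. by rewrite /gform /Fy /hess_alpha !formE; ring. Qed.

Lemma gform_comb_r x y r u v w :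
  gform x y w (r *: u + v) = r * gform x y w u + gform x y w v.
Proof. by rewrite /gform /Fy /hess_alpha !formE; ring. Qed.

Lemma fund_tensorE x y i j : U x -> y != 0 ->
  fund_tensor F x y i j = gform x y (e_ i) (e_ j).
Proof. by move=> Ux y0; rewrite mxE dyyF2 // mulKf. Qed.

Lemma fund_formE x y u v : U x -> y != 0 -> fund_form F x y u v = gform x y u v.
Proof.
move=> Ux y0; rewrite /fund_form.
rewrite -(sum_delta u (f := fun u => gform x y u v)); last first.
  by move=> r p q; exact: gform_comb_l.
apply: eq_bigr => i _; rewrite -(sum_delta v (f := fun v => gform x y (e_ i) v)).
  by rewrite big_distrr; apply: eq_bigr => j _ /=; rewrite fund_tensorE //; ring.
by move=> r p q; exact: gform_comb_r.
Qed.

(* [geod_coef] is [spray0 + sprayP y]: up to a projective factor, the spray of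
   [F] is that of [a] plus [alpha s^i_0]. *)
Definition spray0 x y : V := 2^-1 *: Gam x y y + al x y *: sharp x y.
Definition sprayP x y : R := - (al x y * lf (b x) (sharp x y) / F x y).

Lemma smat_diag x y : bf (smat x) y y = 0.
Proof. exact: eq_opp_0 (bf_anti y y (smat_anti x)). Qed.

(** The classical spray of a Randers metric has projective factor e_00 / (2F) - s_0. For a Killing
    form e_00 = 2 beta s_0, which leaves - alpha s_0 / F, the value of [sprayP]. Here the resulting
    spray is substituted into the equations that define [geod_coef]. *)
Lemma euler_lagrange x y w : U x -> y != 0 ->
  2 * (Fy x y w * Fx x y y + F x y * Fxy x y y w) - 2 * F x y * Fx x y w =
  4 * gform x y w (spray0 x y + sprayP x y *: y).
Proof.
move=> Ux y0; have al0 := lt0r_neq0 (alpha_gt0 Ux y0).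
have := lt0r_neq0 (randers_gt0 Ux y0).
rewrite /gform /Fx /Fxy /Fy /hess_alpha /spray0 /sprayP !formE randersE.
rewrite !bf_dmx // !lf_drow // (GamC w y Ux) smat_diag.
rewrite (bf_anti y w (smat_anti x)) !(bf_sym w _ (asym Ux)) !bf_sharp //.
rewrite smat_diag -(alpha_sqr y Ux).
move: (al x y) al0 => A A0.
move: (lf _ _) (lf _ _) (lf _ _) (lf _ _) (lf _ _) => B1 B2 B3 B4 B5.
move: (bf _ _ _) (bf _ _ _) (bf _ _ _) (bf _ _ _) (bf _ _ _) => C1 C2 C3 C4 C5.
by move=> H; field; rewrite A0.
Qed.

Lemma Fy_self x y : U x -> y != 0 -> Fy x y y = F x y.
Proof.
move=> Ux y0; rewrite /Fy randersE -(alpha_sqr y Ux) expr2 mulfK //.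
exact: lt0r_neq0 (alpha_gt0 Ux y0).
Qed.

Lemma hess_alpha_self x y w : U x -> y != 0 -> hess_alpha x y w y = 0.
Proof.
move=> Ux y0; rewrite /hess_alpha -(alpha_sqr y Ux).
by field; exact: lt0r_neq0 (alpha_gt0 Ux y0).
Qed.

(** Pairing with [y] gives F_y(v) = 0. What remains is the Hessian of alpha, whose kernel is the
    line of [y], and F_y is nonzero on that line. *)
Lemma gform_nondegenerate x y v : U x -> y != 0 ->
  (forall z, gform x y v z = 0) -> v = 0.
Proof.
move=> Ux y0 gv; have F0 := lt0r_neq0 (randers_gt0 Ux y0).
have al0 := lt0r_neq0 (alpha_gt0 Ux y0).
have Fv : Fy x y v = 0.
  have := gv y; rewrite /gform Fy_self // hess_alpha_self // mulr0 addr0.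
  by move/eqP; rewrite mulf_eq0 (negPf F0) orbF => /eqP.
have vE : v = (bf (a x) v y / al x y ^+ 2) *: y.
  apply: (bf_inj (apos Ux)) => z; rewrite bfZl.
  have := gv z; rewrite /gform Fv mul0r add0r => /eqP.
  rewrite mulf_eq0 (negPf F0) /= /hess_alpha subr_eq0 => /eqP H.
  rewrite -[LHS](mulfVK al0) [X in X * _]mulrC [X in X * _]mulrC H (bf_sym y z (asym Ux)).
  by field.
move: Fv; rewrite vE; move: (_ / _) => c.
rewrite /Fy bfZl lfZ -mulrA -mulrDr -/(Fy x y y) Fy_self // => /eqP.
by rewrite mulf_eq0 (negPf F0) orbF => /eqP ->; rewrite scale0r.
Qed.

Lemma fund_tensor_unit x y : U x -> y != 0 -> fund_tensor F x y \in unitmx.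
Proof.
move=> Ux y0; apply/negPn/negP; rewrite -row_free_unit -kermx_eq0 => /rowV0Pn [v].
move=> /sub_kermxP vg; apply/negP; rewrite negbK; apply/eqP.
apply: (gform_nondegenerate Ux y0) => z; rewrite -fund_formE //.
have -> : fund_form F x y v z = bf (fund_tensor F x y) v z by rewrite bf.unlock.
by rewrite bfE vg mul0mx mxE.
Qed.

Lemma geod_coefE x y i : U x -> y != 0 ->
  geod_coef F i x y = (spray0 x y + sprayP x y *: y) 0 i.
Proof.
move=> Ux y0; set G := spray0 x y + sprayP x y *: y.
have EL l : \sum_k dy l (dx k (F2 F)) x y * y 0 k - dx l (F2 F) x y =
    4 * gform x y (e_ l) G.
  rewrite -euler_lagrange // dxF2 //; congr (_ - _).
  rewrite -(sum_delta y (f := fun v => 2 * (Fy x y (e_ l) * Fx x y v + F x y * Fxy x y v (e_ l)))).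
    by apply: eq_bigr => k _; rewrite dyxF2 // mulrC.
  move=> r u v; rewrite /Fx /Fxy dmx_comb ?drow_comb; try exact: ad; try exact: bd.
  by rewrite !bf_lincomb !lf_lincomb; ring.
rewrite /geod_coef (eq_bigr (fun l =>
  4 * (invmx (fund_tensor F x y) i l * gform x y (e_ l) G))); last first.
  by move=> l _; rewrite EL; ring.
rewrite -big_distrr /= mulKf //.
have gE l : gform x y (e_ l) G = (fund_tensor F x y *m G^T) l 0.
  rewrite -(sum_delta G (f := fun v => gform x y (e_ l) v)).
    by rewrite [RHS]mxE; apply: eq_bigr => m _; rewrite fund_tensorE // [G^T _ _]mxE mulrC.
  by move=> r u v; exact: gform_comb_r.
rewrite (eq_bigr _ (fun l _ => congr1 ( *%R _) (gE l))).
transitivity ((invmx (fund_tensor F x y) *m (fund_tensor F x y *m G^T)) i 0).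
  by rewrite [RHS]mxE.
by rewrite mulKmx ?fund_tensor_unit // mxE.
Qed.

(** * First and second derivatives of the spray *)

Lemma sharp_lf x v i : sharp x v 0 i = lf (row i (smix x)) v.
Proof. by rewrite lf.unlock mxE; apply: eq_bigr => j _; rewrite !mxE mulrC. Qed.

Lemma is_derive_sharp x y w i : is_derive y w (fun y => sharp x y 0 i) (sharp x w 0 i).
Proof.
rewrite (funext (fun y => sharp_lf x y i)) sharp_lf; exact: is_derive_lf.
Qed.

Lemma is_derive_dsharp v x y w i :
  is_derive y w (fun y => dsharp v x y 0 i) (dsharp v x w 0 i).
Proof.
have E z : dsharp v x z 0 i = lf (row i (dmx (smix) v x)) z.
  by rewrite lf.unlock mxE; apply: eq_bigr => j _; rewrite !mxE mulrC.
by rewrite (funext E) E; exact: is_derive_lf.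
Qed.

Lemma is_derive_lf_linear (c : V) (S : V -> V) y w :
  (forall i, is_derive y w (fun y => S y 0 i) (S w 0 i)) ->
  is_derive y w (fun y => lf c (S y)) (lf c (S w)).
Proof.
by move=> SD; rewrite lf.unlock; apply: is_derive_sum_pt => i.
Qed.

Definition sb x y : R := lf (b x) (sharp x y).
Definition dsb x y v : R := lf (drow b v x) (sharp x y) + lf (b x) (dsharp v x y).
Definition dalpha x y v : R := bf (dmx a v x) y y / (2 * al x y).

Definition sprayP_x x y v : R :=
  - ((dalpha x y v * sb x y + al x y * dsb x y v) / F x y
     - al x y * sb x y * Fx x y v / F x y ^+ 2).
Definition sprayP_y x y w : R :=
  - ((bf (a x) w y / al x y * sb x y + al x y * sb x w) / F x y
     - al x y * sb x y * Fy x y w / F x y ^+ 2).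

Let s0_y x y w : is_derive y w (sb x) (sb x w).
Proof. by apply: is_derive_lf_linear => i; exact: is_derive_sharp. Qed.

Let s0_x x y v : U x -> is_derive x v (fun x => sb x y) (dsb x y v).
Proof.
move=> Ux; have := is_derive_lf_product v (bd Ux) (fun i => differentiable_sharp y i Ux).
by rewrite (drow_sharp).
Qed.

Lemma is_derive_sprayP_x x y v : U x -> y != 0 ->
  is_derive x v (fun x => sprayP x y) (sprayP_x x y v).
Proof.
move=> Ux y0.
have := is_deriveN_pt (is_deriveM_pt (is_deriveM_pt (is_derive_alpha_x v Ux y0)
  (s0_x y v Ux)) (is_deriveV_pt (f := F^~ y) (randers_neq0 Ux y0) (is_derive_F_x v Ux y0))).
congr (is_derive _ _ _ _); rewrite /sprayP_x /dalpha.
by field; rewrite randers_neq0 ?alpha_neq0.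
Qed.

Lemma is_derive_sprayP_y x y w : U x -> y != 0 ->
  is_derive y w (sprayP x) (sprayP_y x y w).
Proof.
move=> Ux y0.
have := is_deriveN_pt (is_deriveM_pt (is_deriveM_pt (is_derive_alpha_y w Ux y0)
  (s0_y x y w)) (is_deriveV_pt (randers_neq0 Ux y0) (is_derive_F_y w Ux y0))).
congr (is_derive _ _ _ _); rewrite /sprayP_y.
by field; rewrite randers_neq0 ?alpha_neq0.
Qed.

Section DerivableInY.
Variables (x y u : V).
Hypotheses (Ux : U x) (y0 : y != 0).

Let derM (f g : V -> R) : derivable f y u -> derivable g y u ->
  derivable (fun z => f z * g z) y u.
Proof. exact: derivableM. Qed.

Let derD (f g : V -> R) : derivable f y u -> derivable g y u ->
  derivable (fun z => f z + g z) y u.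
Proof. exact: derivableD. Qed.

Let derNB (f g : V -> R) : derivable f y u -> derivable g y u ->
  derivable (fun z => - (f z - g z)) y u.
Proof. by move=> fd gd; exact: derivableN (derivableB fd gd). Qed.

Let dal_y : derivable (al x) y u.
Proof. by have [] := is_derive_alpha_y u Ux y0. Qed.

Let dalV_y : derivable (fun y => (al x y)^-1) y u.
Proof. by apply: derivableV => //; exact: alpha_neq0. Qed.

Let dF_y : derivable (F x) y u.
Proof. by have [] := is_derive_F_y u Ux y0. Qed.

Let dFV_y : derivable (fun y => (F x y)^-1) y u.
Proof. by apply: derivableV => //; exact: randers_neq0. Qed.

Let dFV2_y : derivable (fun y => (F x y ^+ 2)^-1) y u.
Proof.
rewrite (_ : (fun _ => _) = (fun y => (F x y)^-1 * (F x y)^-1)); first exact: derM.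
by apply/funext => z; rewrite expr2 invfM.
Qed.

Let ds_y : derivable (sb x) y u.
Proof. by have [] := s0_y x y u. Qed.

(** Existence suffices here and in [derivable_sprayP_y]: these second derivatives of the projective
    factor enter R^i_k only in the coefficient of y^i. *)
Lemma derivable_sprayP_x v : derivable (fun y => sprayP_x x y v) y u.
Proof.
have quad : derivable (fun y => bf (dmx a v x) y y) y u.
  by have [] := is_derive_quad (dmx a v x) y u.
have al2V : derivable (fun y => (2 * al x y)^-1) y u.
  apply: derivableV; first by rewrite mulf_neq0 // alpha_neq0.
  exact: derM (derivable_cst _ _ _) dal_y.
have dsb1 : derivable (fun y => lf (drow b v x) (sharp x y)) y u.
  by have [] := is_derive_lf_linear (drow b v x) (is_derive_sharp x y u).
have dsb2 : derivable (fun y => lf (b x) (dsharp v x y)) y u.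
  by have [] := is_derive_lf_linear (b x) (is_derive_dsharp v x y u).
have dFx : derivable (fun y => Fx x y v) y u.
  by have [] := is_derive_Fx_y v u Ux y0.
exact: derNB (derM (derD (derM (derM quad al2V) ds_y) (derM dal_y (derD dsb1 dsb2))) dFV_y)
  (derM (derM (derM dal_y ds_y) dFx) dFV2_y).
Qed.

Lemma derivable_sprayP_y w : derivable (fun y => sprayP_y x y w) y u.
Proof.
have lin : derivable (bf (a x) w) y u by have [] := is_derive_bfr (a x) w y u.
have dFy : derivable (fun y => Fy x y w) y u.
  by have [] := is_derive_Fy w u Ux y0.
exact: derNB (derM (derD (derM (derM lin dalV_y) ds_y)
    (derM dal_y (derivable_cst (sb x w) _ _))) dFV_y)
  (derM (derM (derM dal_y ds_y) dFy) dFV2_y).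
Qed.

End DerivableInY.

(* [spray0_x] is the derivative of [spray0] along [v] in the variable x,
   and similarly for the other subscripts. *)
Definition spray0_x x y v : V :=
  2^-1 *: dGam v x y y + dalpha x y v *: sharp x y + al x y *: dsharp v x y.
Definition spray0_y x y w : V :=
  Gam x w y + (bf (a x) w y / al x y) *: sharp x y + al x y *: sharp x w.
Definition spray0_xy x y v w : V :=
  dGam v x w y
  + (bf (dmx a v x) w y / al x y
     - bf (dmx a v x) y y * bf (a x) w y / (2 * al x y ^+ 3)) *: sharp x y
  + dalpha x y v *: sharp x w + (bf (a x) w y / al x y) *: dsharp v x y
  + al x y *: dsharp v x w.
Definition spray0_yy x y w u : V :=
  Gam x w u + hess_alpha x y w u *: sharp x y + (bf (a x) w y / al x y) *: sharp x u
  + (bf (a x) u y / al x y) *: sharp x w.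

Lemma dGamC u x v w : U x -> dGam u x v w = dGam u x w v.
Proof.
move=> Ux; rewrite -!drow_Gam //; apply/rowP => i; rewrite !drowE.
apply: near_eq_derive; near=> z; rewrite GamC //.
by near: z; apply: near_open Ux; exact: kc_open L.
Unshelve. all: by end_near. Qed.

Lemma is_derive_dGam u x y w i : U x ->
  is_derive y w (fun y => dGam u x y y 0 i) (2 * dGam u x w y 0 i).
Proof.
move=> Ux; rewrite (_ : (fun _ => _) =
  (fun y => bf (dmx (fun q => gam q i) u x) y y)); last first.
  by apply/funext => z; rewrite mxE.
have := is_derive_quad (dmx (fun q => gam q i) u x) y w.
congr (is_derive _ _ _ _); have /rowP /(_ i) := dGamC u w y Ux.
by rewrite !mxE => <-; ring.
Qed.

Lemma is_derive_Gam x y w i : U x ->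
  is_derive y w (fun y => Gam x y y 0 i) (2 * Gam x w y 0 i).
Proof.
move=> Ux; rewrite (_ : (fun _ => _) = (fun y => bf (gam x i) y y)); last first.
  by apply/funext => z; rewrite mxE.
have := is_derive_quad (gam x i) y w.
congr (is_derive _ _ _ _); have /rowP /(_ i) := GamC w y Ux.
by rewrite !mxE => <-; ring.
Qed.

Lemma is_derive_Gam_l x y v w i :
  is_derive y w (fun y => Gam x v y 0 i) (Gam x v w 0 i).
Proof.
rewrite (_ : (fun _ => _) = bf (gam x i) v); last first.
  by apply/funext => z; rewrite mxE.
by rewrite mxE; exact: is_derive_bfr.
Qed.

Lemma rv_add (p q : V) i : (p + q) 0 i = p 0 i + q 0 i.
Proof. by rewrite mxE. Qed.
Lemma rv_scale (c : R) (p : V) i : (c *: p) 0 i = c * p 0 i.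
Proof. by rewrite mxE. Qed.
Definition rvE := (rv_add, rv_scale).

Lemma is_derive_spray0_x x y v i : U x -> y != 0 ->
  is_derive x v (fun x => spray0 x y 0 i) (spray0_x x y v 0 i).
Proof.
move=> Ux y0; rewrite (_ : (fun x => _) =
  (fun x => 2^-1 * Gam x y y 0 i + al x y * sharp x y 0 i)); last first.
  by apply/funext => z; rewrite /spray0 !rvE.
have GD := derivableP (diff_derivable (v := v) (differentiable_Gam y y i Ux)).
have SD := derivableP (diff_derivable (v := v) (differentiable_sharp y i Ux)).
have := is_deriveD_pt (is_deriveM_pt (is_derive_cst_pt (2^-1 : R) x v) GD)
  (is_deriveM_pt (is_derive_alpha_x v Ux y0) SD).
rewrite -(drowE (fun x => Gam x y y)) -(drowE (fun x => sharp x y)).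
rewrite drow_Gam // drow_sharp //.
by congr (is_derive _ _ _ _); rewrite /spray0_x !rvE /dalpha; ring.
Qed.

Lemma is_derive_spray0_y x y w i : U x -> y != 0 ->
  is_derive y w (fun y => spray0 x y 0 i) (spray0_y x y w 0 i).
Proof.
move=> Ux y0; rewrite (_ : (fun x => _) =
  (fun y => 2^-1 * Gam x y y 0 i + al x y * sharp x y 0 i)); last first.
  by apply/funext => z; rewrite /spray0 !rvE.
have := is_deriveD_pt (is_deriveM_pt (is_derive_cst_pt (2^-1 : R) y w)
  (is_derive_Gam y w i Ux)) (is_deriveM_pt (is_derive_alpha_y w Ux y0)
  (is_derive_sharp x y w i)).
by congr (is_derive _ _ _ _); rewrite /spray0_y !rvE; field; exact: alpha_neq0.
Qed.

Lemma is_derive_spray0_yy x y w u i : U x -> y != 0 ->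
  is_derive y u (fun y => spray0_y x y w 0 i) (spray0_yy x y w u 0 i).
Proof.
move=> Ux y0; rewrite (_ : (fun y => _) = (fun y => Gam x w y 0 i +
  (bf (a x) w y / al x y) * sharp x y 0 i + al x y * sharp x w 0 i)); last first.
  by apply/funext => z; rewrite /spray0_y !rvE.
have := is_deriveD_pt (is_deriveD_pt (is_derive_Gam_l x y w u i)
  (is_deriveM_pt (is_derive_bfV u Ux y0 (is_derive_bfr (a x) w y u))
    (is_derive_sharp x y u i)))
  (is_deriveM_pt (is_derive_alpha_y u Ux y0) (is_derive_cst_pt (sharp x w 0 i) y u)).
by congr (is_derive _ _ _ _); rewrite /spray0_yy !rvE /hess_alpha; ring.
Qed.

Lemma is_derive_spray0_xy x y v u i : U x -> y != 0 ->
  is_derive y u (fun y => spray0_x x y v 0 i) (spray0_xy x y v u 0 i).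
Proof.
move=> Ux y0; rewrite (_ : (fun y => _) = (fun y => 2^-1 * dGam v x y y 0 i +
  (2^-1 * (bf (dmx a v x) y y / al x y)) * sharp x y 0 i + al x y * dsharp v x y 0 i)); last first.
  apply/funext => z; rewrite /spray0_x !rvE /dalpha; congr (_ + _ * _ + _).
  by rewrite invfM; ring.
have := is_deriveD_pt (is_deriveD_pt
  (is_deriveM_pt (is_derive_cst_pt (2^-1 : R) y u) (is_derive_dGam v y u i Ux))
  (is_deriveM_pt
    (is_deriveM_pt (is_derive_cst_pt (2^-1 : R) y u)
      (is_derive_bfV u Ux y0 (is_derive_quad (dmx a v x) y u)))
    (is_derive_sharp x y u i)))
  (is_deriveM_pt (is_derive_alpha_y u Ux y0) (is_derive_dsharp v x y u i)).
congr (is_derive _ _ _ _); rewrite /spray0_xy !rvE (bf_sym y u (dmx_sym v Ux)) /dalpha.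
by field; exact: alpha_neq0.
Qed.

(** * The Riemann curvature of the Randers metric *)

Lemma dx_geod k i x y : U x -> y != 0 ->
  dx k (geod_coef F i) x y = spray0_x x y (e_ k) 0 i + sprayP_x x y (e_ k) * y 0 i.
Proof.
move=> Ux y0; rewrite /dx /partial.
rewrite (@near_eq_derive _ _ _ _ (fun x => spray0 x y 0 i + sprayP x y * y 0 i)); last first.
  near=> z; rewrite geod_coefE ?rvE //.
  by near: z; apply: near_open Ux; exact: kc_open L.
have D := is_deriveD_pt (is_derive_spray0_x (e_ k) i Ux y0)
  (is_deriveM_pt (is_derive_sprayP_x (e_ k) Ux y0) (is_derive_cst_pt (y 0 i) x (e_ k))).
by rewrite (derive_val (is_derive := D)); ring.
Unshelve. all: by end_near. Qed.

Lemma dy_geod k i x y : U x -> y != 0 ->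
  dy k (geod_coef F i) x y =
  spray0_y x y (e_ k) 0 i + sprayP_y x y (e_ k) * y 0 i + sprayP x y * (e_ k) 0 i.
Proof.
move=> Ux y0; rewrite /dy /partial.
rewrite (@near_eq_derive _ _ _ _ (fun y => spray0 x y 0 i + sprayP x y * y 0 i)); last first.
  by apply: filterS (near_neq0 y0) => z z0; rewrite geod_coefE ?rvE.
have D := is_deriveD_pt (is_derive_spray0_y (e_ k) i Ux y0)
  (is_deriveM_pt (is_derive_sprayP_y (e_ k) Ux y0) (is_derive_coord y (e_ k) i)).
by rewrite (derive_val (is_derive := D)); ring.
Qed.

Lemma dyx_geod k m i x y : U x -> y != 0 ->
  dy k (dx m (geod_coef F i)) x y =
  spray0_xy x y (e_ m) (e_ k) 0 i + 'D_(e_ k) (fun y => sprayP_x x y (e_ m)) y * y 0 i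
  + sprayP_x x y (e_ m) * (e_ k) 0 i.
Proof.
move=> Ux y0; rewrite /dy /partial.
rewrite (@near_eq_derive _ _ _ _ (fun y => spray0_x x y (e_ m) 0 i + sprayP_x x y (e_ m) * y 0 i));
  last first.
  by apply: filterS (near_neq0 y0) => z z0; rewrite dx_geod.
have D := is_deriveD_pt (is_derive_spray0_xy (e_ m) (e_ k) i Ux y0)
  (is_deriveM_pt (derivableP (derivable_sprayP_x (u := e_ k) (v := e_ m) Ux y0))
    (is_derive_coord y (e_ k) i)).
by rewrite (derive_val (is_derive := D)); ring.
Qed.

Lemma dyy_geod k m i x y : U x -> y != 0 ->
  dy k (dy m (geod_coef F i)) x y =
  spray0_yy x y (e_ m) (e_ k) 0 i + 'D_(e_ k) (fun y => sprayP_y x y (e_ m)) y * y 0 i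
  + sprayP_y x y (e_ m) * (e_ k) 0 i + sprayP_y x y (e_ k) * (e_ m) 0 i.
Proof.
move=> Ux y0; rewrite -[LHS]/('D_(e_ k) (dy m (geod_coef F i) x) y).
rewrite (@near_eq_derive _ _ _ _ (fun y =>
  spray0_y x y (e_ m) 0 i + sprayP_y x y (e_ m) * y 0 i + sprayP x y * (e_ m) 0 i));
  last first.
  by apply: filterS (near_neq0 y0) => z z0; rewrite dy_geod.
have D := is_deriveD_pt (is_deriveD_pt (is_derive_spray0_yy (e_ m) (e_ k) i Ux y0)
  (is_deriveM_pt (derivableP (derivable_sprayP_y (u := e_ k) (w := e_ m) Ux y0))
    (is_derive_coord y (e_ k) i)))
  (is_deriveM_pt (is_derive_sprayP_y (e_ k) Ux y0) (is_derive_cst_pt ((e_ m) 0 i) y (e_ k))).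
by rewrite (derive_val (is_derive := D)); ring.
Qed.

Lemma dsharp_comb_r q x r u v :
  dsharp q x (r *: u + v) = r *: dsharp q x u + dsharp q x v.
Proof. by rewrite /dsharp mulmxDl scalemxAl. Qed.

Lemma dsharp_comb_l x r u v q : U x ->
  dsharp (r *: u + v) x q = r *: dsharp u x q + dsharp v x q.
Proof.
move=> Ux; rewrite /dsharp dmx_comb; last by move=> i j; exact: (differentiable_smix).
by rewrite linearP mulmxDr -scalemxAr.
Qed.

Lemma dGam_comb_l x r u v p q : U x ->
  dGam (r *: u + v) x p q = r *: dGam u x p q + dGam v x p q.
Proof.
move=> Ux; apply/rowP => i; rewrite rvE rv_scale 3!mxE dmx_comb ?bf_lincomb //.
by move=> j k; exact: (differentiable_gam).
Qed.

Lemma dGam_comb_m x r u v p q :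
  dGam p x (r *: u + v) q = r *: dGam p x u q + dGam p x v q.
Proof. by apply/rowP => i; rewrite rvE rv_scale 3!mxE !formE. Qed.

Lemma spray0_y_comb x y r u v : spray0_y x y (r *: u + v) = r *: spray0_y x y u + spray0_y x y v.
Proof.
rewrite /spray0_y; apply/rowP => i; rewrite Gam_comb_l sharp_comb !rvE !formE; ring.
Qed.

Lemma spray0_yy_comb_l x y r u v w :
  spray0_yy x y (r *: u + v) w = r *: spray0_yy x y u w + spray0_yy x y v w.
Proof.
rewrite /spray0_yy /hess_alpha; apply/rowP => i.
rewrite Gam_comb_l sharp_comb !rvE !formE; ring.
Qed.

Lemma spray0_yy_comb_r x y r u v w :
  spray0_yy x y w (r *: u + v) = r *: spray0_yy x y w u + spray0_yy x y w v.
Proof.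
rewrite /spray0_yy /hess_alpha; apply/rowP => i.
rewrite Gam_comb_r sharp_comb !rvE !formE; ring.
Qed.

Lemma spray0_x_comb x y r u v : U x ->
  spray0_x x y (r *: u + v) = r *: spray0_x x y u + spray0_x x y v.
Proof.
move=> Ux; rewrite /spray0_x /dalpha; apply/rowP => i.
rewrite dGam_comb_l // dsharp_comb_l // dmx_comb; last exact: ad.
rewrite bf_lincomb !rvE; ring.
Qed.

Lemma spray0_xy_comb_l x y r u v w : U x ->
  spray0_xy x y (r *: u + v) w = r *: spray0_xy x y u w + spray0_xy x y v w.
Proof.
move=> Ux; rewrite /spray0_xy /dalpha; apply/rowP => i.
rewrite dGam_comb_l // !dsharp_comb_l // dmx_comb; last exact: ad.
rewrite !bf_lincomb !rvE; ring.
Qed.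

Lemma spray0_xy_comb_r x y r u v w :
  spray0_xy x y w (r *: u + v) = r *: spray0_xy x y w u + spray0_xy x y w v.
Proof.
rewrite /spray0_xy /dalpha; apply/rowP => i.
rewrite dGam_comb_m dsharp_comb_r sharp_comb !rvE !formE; ring.
Qed.

(* Euler's identities: [spray0] is 2-homogeneous in [y]. *)
Lemma spray0_yy_self x y w : U x -> y != 0 -> spray0_yy x y y w = spray0_y x y w.
Proof.
move=> Ux y0; rewrite /spray0_yy /spray0_y /hess_alpha; apply/rowP => i.
rewrite (bf_sym y w (kc_sym L Ux)) -(alpha_sqr y Ux) (GamC y w Ux) !rvE.
by field; exact: alpha_neq0.
Qed.

Lemma spray0_y_self x y : U x -> y != 0 -> spray0_y x y y = 2 *: spray0 x y.
Proof.
move=> Ux y0; rewrite /spray0_y /spray0; apply/rowP => i.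
rewrite -(alpha_sqr y Ux) !rvE; field; exact: alpha_neq0.
Qed.

(* The Riemann operator of the spray [spray0]. *)
Definition Rhat x y u : V :=
  2 *: spray0_x x y u - spray0_xy x y y u + 2 *: spray0_yy x y (spray0 x y) u
  - spray0_y x y (spray0_y x y u).

Lemma Rhat_comb x y r u v : U x -> Rhat x y (r *: u + v) = r *: Rhat x y u + Rhat x y v.
Proof.
move=> Ux; rewrite /Rhat spray0_x_comb // spray0_xy_comb_r spray0_yy_comb_r !spray0_y_comb.
by apply/rowP => i; rewrite !(rvE, mxE) ; ring.
Qed.

(** Only the shape of the correction matters. The terms [P *: spray0_y x y (e_ k)] and
    [p k *: spray0 x y], which do not have this shape, cancel by Euler's identities for the
    2-homogeneous [spray0]. *)
Lemma riemann_curv_mod x y : U x -> y != 0 ->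
  exists (X : R) (Y : 'I_n -> R), forall i k,
    riemann_curv F i k x y = Rhat x y (e_ k) 0 i + X * (e_ k) 0 i + Y k * y 0 i.
Proof.
move=> Ux y0; pose P := sprayP x y; pose p k := sprayP_y x y (e_ k).
pose G := spray0 x y + P *: y.
(* The derivative of the full spray [G] in the variable y^k. *)
pose W k : V := spray0_y x y (e_ k) + p k *: y + P *: e_ k.
exists (- (\sum_m sprayP_x x y (e_ m) * y 0 m) + 2 * (\sum_m G 0 m * p m) - P ^+ 2).
exists (fun k => 2 * sprayP_x x y (e_ k)
  - (\sum_m 'D_(e_ k) (fun y => sprayP_x x y (e_ m)) y * y 0 m)
  + 2 * (\sum_m G 0 m * 'D_(e_ k) (fun y => sprayP_y x y (e_ m)) y)
  + 2 * p k * P - (\sum_m W k 0 m * p m) - P * p k) => i k.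
rewrite /riemann_curv dx_geod //.
have -> : \sum_m dy k (dx m (geod_coef F i)) x y * y 0 m =
    spray0_xy x y y (e_ k) 0 i
    + (\sum_m 'D_(e_ k) (fun y => sprayP_x x y (e_ m)) y * y 0 m) * y 0 i
    + (\sum_m sprayP_x x y (e_ m) * y 0 m) * (e_ k) 0 i.
  rewrite -(sum_delta y (f := fun v => spray0_xy x y v (e_ k) 0 i)); last first.
    by move=> r u v; rewrite spray0_xy_comb_l // rvE rv_scale.
  rewrite !big_distrl -!big_split; apply: eq_bigr => m _ /=.
  by rewrite dyx_geod //; ring.
have -> : \sum_m geod_coef F m x y * dy k (dy m (geod_coef F i)) x y =
    (spray0_yy x y G (e_ k) 0 i + p k * G 0 i)
    + (\sum_m G 0 m * 'D_(e_ k) (fun y => sprayP_y x y (e_ m)) y) * y 0 i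
    + (\sum_m G 0 m * p m) * (e_ k) 0 i.
  rewrite -(sum_delta G (f := fun v => spray0_yy x y v (e_ k) 0 i + p k * v 0 i)); last first.
    by move=> r u v; rewrite spray0_yy_comb_l !rvE; ring.
  rewrite !big_distrl -!big_split; apply: eq_bigr => m _ /=.
  by rewrite dyy_geod // geod_coefE // -/P -/G /p; ring.
have -> : \sum_m dy m (geod_coef F i) x y * dy k (geod_coef F m) x y =
    (spray0_y x y (W k) 0 i + P * W k 0 i) + (\sum_m W k 0 m * p m) * y 0 i.
  rewrite -(sum_delta (W k) (f := fun v => spray0_y x y v 0 i + P * v 0 i)); last first.
    by move=> r u v; rewrite spray0_y_comb !rvE; ring.
  rewrite big_distrl -big_split; apply: eq_bigr => m _ /=.
  by rewrite !dy_geod // -/P /W !rvE /p; ring.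
have HG : spray0_yy x y G (e_ k) = spray0_yy x y (spray0 x y) (e_ k) + P *: spray0_y x y (e_ k).
  by rewrite /G addrC spray0_yy_comb_l spray0_yy_self // addrC.
have HW : spray0_y x y (W k) = spray0_y x y (spray0_y x y (e_ k)) + (2 * p k) *: spray0 x y
    + P *: spray0_y x y (e_ k).
  rewrite /W addrC spray0_y_comb addrC (addrC (spray0_y x y (e_ k))) spray0_y_comb spray0_y_self //.
  by rewrite scalerA (mulrC 2) (addrC (_ *: spray0 _ _)).
rewrite HG HW /W /G /Rhat !rvE.
have rvN (q : V) : (- q) 0 i = - q 0 i by rewrite mxE.
rewrite !rvN !rvE; ring.
Qed.

Lemma spray0_xy_self x y v : U x -> y != 0 -> spray0_xy x y v y = 2 *: spray0_x x y v.
Proof.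
move=> Ux y0; rewrite /spray0_xy /spray0_x /dalpha; apply/rowP => i.
rewrite -(alpha_sqr y Ux) !rvE; field; exact: alpha_neq0.
Qed.

Lemma H2C x y u v : U x -> spray0_yy x y u v = spray0_yy x y v u.
Proof.
move=> Ux; rewrite /spray0_yy /hess_alpha; apply/rowP => i.
rewrite (bf_sym u v (asym Ux)) (GamC u v Ux) !rvE; ring.
Qed.

Lemma Rhat_self x y : U x -> y != 0 -> Rhat x y y = 0.
Proof.
move=> Ux y0; rewrite /Rhat spray0_xy_self // subrr add0r H2C // spray0_yy_self //.
have two (v : V) : 2 *: v = 1 *: v + v by rewrite scale1r scaler_nat mulr2n.
by rewrite spray0_y_self // !two spray0_y_comb subrr.
Qed.

Lemma GamDl x u v w : Gam x (u + v) w = Gam x u w + Gam x v w.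
Proof. by apply/rowP => i; rewrite !mxE !formE. Qed.
Lemma GamZl x r v w : Gam x (r *: v) w = r *: Gam x v w.
Proof. by apply/rowP => i; rewrite !mxE !formE. Qed.
Lemma sharpD x u v : sharp x (u + v) = sharp x u + sharp x v.
Proof. exact: mulmxDl. Qed.
Lemma sharpZ x r v : sharp x (r *: v) = r *: sharp x v.
Proof. by rewrite /sharp scalemxAl. Qed.

(** Orthogonality removes the derivative of alpha along [u]. Of the coefficient 3, two units come
    from the Hessian of alpha in [spray0_yy] and one from [spray0_y] applied twice; the latter also
    yields the term in |s#u|^2. *)
Lemma bf_Rhat x y u : U x -> y != 0 -> bf (a x) u y = 0 ->
  bf (a x) (Rhat x y u) u = bf (a x) (curv x u y y) u
  + 3 * bf (smat x) u y ^+ 2 + al x y ^+ 2 * bf (a x) (sharp x u) (sharp x u)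
  + 2 * al x y * nabla_s x u y u.
Proof.
move=> Ux y0 uy; have A0 := alpha_neq0 Ux y0.
(* The term with the derivative of s# along [y] is alpha <(nabla_y s#)u, u>, which is zero by
   skew-symmetry; [N] is solved for its noncovariant part [p]. *)
have N := eq_opp_0 (nabla_s_anti y u u Ux).
have := N; rewrite /nabla_s /curv /Rhat /spray0_x /spray0_xy /spray0_yy /spray0_y /spray0.
rewrite /dalpha /hess_alpha !formE uy !(mul0r, mulr0, scale0r, addr0, subr0).
rewrite !(GamDl, GamZl, sharpD, sharpZ, formE) !bf_dmx // !bf_sharp //.
rewrite (GamC (Gam x y y) u Ux) (GamC (Gam x u y) y Ux) (GamC (sharp x y) u Ux).
rewrite (GamC (sharp x u) y Ux) (GamC y u Ux) !(smat_diag x).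
rewrite (bf_anti y u (smat_anti x)) (bf_anti u (sharp x u) (smat_anti x)).
set p := bf (a x) (dsharp y x u) u; move: p => p N0.
have -> : p = bf (smat x) u (Gam x u y) - bf (a x) (Gam x y (sharp x u)) u by lra.
by field.
Qed.

(** * From flag curvature to a quadratic form on the orthogonal of the flagpole *)

Lemma riemann_opE x y : U x -> y != 0 ->
  exists X : R, forall u, exists c : R,
    riemann_op F x y u = Rhat x y u + X *: u + c *: y.
Proof.
move=> Ux y0; have [X [Y RE]] := riemann_curv_mod Ux y0.
have := Rhat_comb y; move=> /(_ x) SL; move: (Rhat x y) RE SL => S RE SL.
exists X => u; exists (\sum_k u 0 k * Y k); apply/rowP => i.
rewrite mxE !rvE big_distrl -(sum_delta u (f := fun v => S v 0 i + X * v 0 i)).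
  by rewrite -big_split; apply: eq_bigr => k _; rewrite RE /=; ring.
by move=> r p q; rewrite SL // !rvE; ring.
Qed.

Lemma row_free_orthogonal x y u c : U x -> y != 0 -> u != 0 -> bf (a x) u y = 0 ->
  row_free (col_mx y (u + c *: y)).
Proof.
move=> Ux y0 u0 uy; rewrite -kermx_eq0; apply/rowV0P => v /sub_kermxP.
rewrite -(hsubmxK v) mul_row_col (mx11_scalar (lsubmx v)) (mx11_scalar (rsubmx v)).
move: (lsubmx v 0 0) (rsubmx v 0 0) => p q; rewrite !mul_scalar_mx => E.
have q0 : q = 0.
  have := congr1 (fun w => bf (a x) u w) E.
  rewrite !formE uy !mulr0 addr0 add0r bf0r => /eqP.
  by rewrite mulf_eq0 bf_eq0 ?(negPf u0) ?orbF; [move/eqP|exact: kc_pos L _ Ux].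
move: E; rewrite q0 scale0r addr0 => /eqP.
rewrite scaler_eq0 (negPf y0) orbF => /eqP ->.
by rewrite raddf0 row_mx0.
Qed.

(** The flag of [u] is also spanned by an edge [u'] that is g_y-orthogonal to [y]. On such an edge
    g_y(v, u') is F / alpha times <v, u>, so the flag curvature becomes a quotient formed with the
    Riemannian metric. *)
Lemma flag_isotropic x y K : U x -> y != 0 ->
  (forall u, row_free (col_mx y u) -> flag_curv F x y u = K) ->
  exists A : R, forall u, bf (a x) u y = 0 ->
    bf (a x) (Rhat x y u) u = A * bf (a x) u u.
Proof.
move=> Ux y0 flagK; have [X RE] := riemann_opE Ux y0.
have A0 := alpha_neq0 Ux y0; have F0 := lt0r_neq0 (randers_gt0 Ux y0).
exists (K * F x y ^+ 2 - X) => u uy.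
have [->|u0] := eqVneq u 0; first by rewrite !bf0r mulr0.
(* Since F_y(y) = F, this [t] makes F_y(u') zero. *)
pose t := - (Fy x y u / F x y); pose u' := u + t *: y.
have Fu' : Fy x y u' = 0.
  have -> : Fy x y u' = Fy x y u + t * Fy x y y.
    by rewrite /Fy /u' !formE; ring.
  by rewrite Fy_self // /t; field.
have gu' v : gform x y v u' = F x y / al x y * bf (a x) v u.
  rewrite /gform Fu' mulr0 add0r.
  have -> : hess_alpha x y v u' = hess_alpha x y v u + t * hess_alpha x y v y.
    by rewrite /hess_alpha /u' !formE; ring.
  by rewrite hess_alpha_self // /hess_alpha uy; field.
have [c Rc] := RE u'.
have Ru' : riemann_op F x y u' = Rhat x y u + X *: u + (X * t + c) *: y.
  rewrite Rc /u' addrC (addrC u) Rhat_comb // Rhat_self // scaler0 add0r.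
  by move: (Rhat x y u) => S; apply/rowP => i; rewrite !rvE; ring.
have uu : bf (a x) u u != 0 by rewrite bf_eq0 //; exact: kc_pos L _ Ux.
have := flagK u' (row_free_orthogonal t Ux y0 u0 uy).
rewrite /flag_curv !fund_formE // !gu' Ru'.
have -> : gform x y u' y = 0.
  by rewrite /gform Fu' mul0r add0r hess_alpha_self // mulr0.
have -> : gform x y y y = F x y ^+ 2.
  by rewrite /gform hess_alpha_self // Fy_self // mulr0 addr0.
rewrite /u' !formE (bf_sym y u (asym Ux)) uy => <-.
by field; rewrite F0 A0 uu.
Qed.

(** * Scalar flag curvature at a point *)

Section ScalarFlagCurvature.
Variable x : V.
Hypothesis Ux : U x.
Hypothesis bx0 : b x != 0.
Hypothesis flagK : forall y, y != 0 -> exists K, forall u,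
  row_free (col_mx y u) -> flag_curv (randers a b) x y u = K.

Local Notation "<< v , w >>" := (bf (a x) v w).
Local Notation S := (sharp x).
Local Notation B := (bvec x).

Let gC v w : <<v, w>> = <<w, v>>.
Proof. exact: bf_sym (kc_sym L Ux). Qed.

Let g_eq0 v : (<<v, v>> == 0) = (v == 0).
Proof. by apply: bf_eq0; exact: kc_pos L _ Ux. Qed.

Lemma bvec_neq0 : B != 0.
Proof.
apply: contraNneq bx0 => B0; apply/eqP; apply: lf_eq => z.
by rewrite -lf_bvec // B0 bf0l lf.unlock big1 // => i _; rewrite mxE mul0r.
Qed.

Let SC v w : <<S v, w>> = - <<v, S w>>.
Proof.
by rewrite (gC v) !bf_sharp // (bf_anti w v (smat_anti x)).
Qed.

Let S0 v : <<S v, v>> = 0.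
Proof. by rewrite bf_sharp // smat_diag. Qed.

Let curvNN e u : <<curv x e (- u) (- u), e>> = <<curv x e u u, e>>.
Proof.
rewrite curv_pair // bfNr curv_pair // curv_anti // bfNr.
by rewrite opprK -curv_anti ?opprK // [in RHS](curv_anti).
Qed.

Let nablaN u y : nabla_s x u (- y) u = - nabla_s x u y u.
Proof.
by rewrite !(nabla_s_anti _ _ u) // /nabla_s bfNr opprK.
Qed.

Let flag_symmetric y : y != 0 -> exists A A', forall u, <<u, y>> = 0 ->
  <<curv x u y y, u>> + 3 * bf (smat x) u y ^+ 2 + <<y, y>> * <<S u, S u>>
    = A * <<u, u>> /\
  2 * alpha a x y * nabla_s x u y u = A' * <<u, u>>.
Proof.
move=> y0; have Ny0 : - y != 0 by rewrite oppr_eq0.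
have [K1 /(flag_isotropic Ux y0) [A1 H1]] := flagK y0.
have [K2 /(flag_isotropic Ux Ny0) [A2 H2]] := flagK Ny0.
(* [A1] and [A2] belong to the poles [y] and [- y], which have the same orthogonal complement; the
   half-sum and half-difference of the two identities are the even and odd parts. *)
exists ((A1 + A2) / 2), ((A1 - A2) / 2) => u uy.
have uNy : <<u, - y>> = 0 by rewrite bfNr uy oppr0.
have := H1 u uy; have := H2 u uNy; rewrite !bf_Rhat //.
rewrite curvNN nablaN alphaN bfNr sqrrN mulrN alpha_sqr //.
move: (2 * alpha a x y * _) => s; move: <<u, u>> <<y, y>> <<S u, S u>> => p q r.
by move=> E1 E2; split; lra.
Qed.

Lemma even_part u : u != 0 -> exists A, forall e, <<e, u>> = 0 ->
  <<curv x e u u, e>> + 3 * bf (smat x) e u ^+ 2 + <<u, u>> * <<S e, S e>>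
    = A * <<e, e>>.
Proof.
by move=> u0; have [A [A2 H]] := flag_symmetric u0; exists A => e /H[].
Qed.

Lemma odd_part y : y != 0 -> exists A, forall u, <<u, y>> = 0 ->
  nabla_s x u y u = A * <<u, u>>.
Proof.
move=> y0; have [A1 [A H]] := flag_symmetric y0.
have al0 : alpha a x y != 0 by exact: lt0r_neq0 (alpha_gt0 Ux y0).
exists (A / (2 * alpha a x y)) => u /H[_ E].
by rewrite mulrAC -E; field.
Qed.

(** The edge [B] is admissible because [y] is orthogonal to it, and there the odd part is - <R(B,
    y)B, B> = 0. Its factor [A] therefore vanishes, for every other edge too. *)
Lemma curv_bvec y u : y != 0 -> <<y, B>> = 0 -> <<u, y>> = 0 ->
  <<curv x u y u, B>> = 0.
Proof.
move=> y0 yB uy; have [A HA] := odd_part y0.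
have BB : <<B, B>> != 0 by rewrite g_eq0 bvec_neq0.
have : nabla_s x B y B = 0.
  rewrite killing_nabla_s // -lf_bvec // gC.
  by rewrite (eq_opp_0 (curv_anti B y B B Ux)) oppr0.
rewrite HA ?(gC B) // => /eqP; rewrite mulf_eq0 (negPf BB) orbF => /eqP A0.
have := HA u uy; rewrite A0 mul0r killing_nabla_s // -lf_bvec // gC.
by move/eqP; rewrite oppr_eq0 => /eqP.
Qed.

(** The edges y + B and y - B have equal length and share the factor [A] of the pole [u];
    [curv_bvec] removes the mixed curvature terms. Subtracting leaves 12 <Sy,u><SB,u> + 4 |u|^2
    <Sy,SB> = 0. *)
Lemma sharp_orthogonal y u : y != 0 -> u != 0 ->
  <<y, B>> = 0 -> <<u, y>> = 0 -> <<u, B>> = 0 ->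
  <<u, u>> * <<S y, S B>> = - 3 * <<S y, u>> * <<S B, u>>.
Proof.
move=> y0 u0 yB uy uB; have [A HA] := even_part u0.
have CE e z : <<curv x e u u, z>> = - <<curv x u z u, e>>.
  by rewrite curv_pair // (curv_anti).
have C1 : <<curv x u y u, B>> = 0 by apply: curv_bvec.
have C2 : <<curv x u B u, y>> = 0 by rewrite (curv_pair).
have Cpm r : <<curv x (y + r *: B) u u, y + r *: B>> =
    - <<curv x u y u, y>> - r ^+ 2 * <<curv x u B u, B>>.
  rewrite bfDr bfZr !CE !bfDr !bfZr C1 C2; ring.
have Ppm r : <<y + r *: B, u>> = 0.
  by rewrite bfDl bfZl (gC y) (gC B) uy uB mulr0 addr0.
have H r := HA _ (Ppm r); move: (H 1) (H (- 1)).
rewrite !Cpm; move: <<curv x u y u, y>> <<curv x u B u, B>> => p1 p2.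
rewrite !sharpD !sharpZ !formE (gC B y) yB (gC (S B) (S y)).
rewrite -!bf_sharp // (SC u y) (SC u B) (gC u (S y)) (gC u (S B)).
move: <<S y, S B>> <<u, u>> <<S y, u>> <<S B, u>> => p3 p4 p5 p6.
move: <<S y, S y>> <<S B, S B>> <<y, y>> <<B, B>> => p7 p8 p9 p10.
by move=> E1 E2; lra.
Qed.

Lemma sharp_bvec_orthogonal y : <<y, B>> = 0 -> <<S y, S B>> = 0.
Proof.
move=> yB; have [->|y0] := eqVneq y 0.
  by rewrite -(scale0r 0) sharpZ !scale0r bf0l.
have BB : <<B, B>> != 0 by rewrite g_eq0 bvec_neq0.
(* This [p] meets all conditions of [sharp_orthogonal]: it is orthogonal to [y] because <Sy, y> = 0
   and [y] is orthogonal to [B]. *)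
pose c := <<S y, B>> / <<B, B>>; pose p := S y - c *: B.
have pE : S y = p + c *: B by rewrite subrK.
have SBp : <<S B, p>> = <<S B, S y>> by rewrite /p !formE S0 mulr0 subr0.
have pB : <<p, B>> = 0 by rewrite /p !formE /c mulfVK // subrr.
have py : <<p, y>> = 0 by rewrite /p !formE S0 (gC B) yB mulr0 subr0.
have [p0|p0] := eqVneq p 0.
  by rewrite pE p0 add0r bfZl gC S0 mulr0.
have := sharp_orthogonal y0 p0 yB py pB.
rewrite SBp (gC (S B)) [in X in _ = _ * X * _]pE bfDl bfZl (gC B) pB mulr0 addr0.
move: <<p, p>> (g_eq0 p) => q; rewrite (negPf p0) => q0 E.
(* Since <Sy, p> = |p|^2 and <SB, p> = <SB, Sy>, both sides are multiples of the same product, with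
   factors 1 and -3. *)
have : 4 * q * <<S y, S B>> = 0 by lra.
by move/eqP; rewrite !mulf_eq0 pnatr_eq0 /= q0 => /eqP.
Qed.

Lemma t0_proportional y :
  t0 a b x y = - (<<S B, S B>> / <<B, B>>) * beta b x y.
Proof.
have BB : <<B, B>> != 0 by rewrite g_eq0 bvec_neq0.
have -> : beta b x y = <<y, B>> by rewrite gC lf_bvec // lf.unlock.
rewrite t0E // -[y in LHS](subrK ((<<y, B>> / <<B, B>>) *: B)).
rewrite sharpD sharpZ !formE (gC (S B)) sharp_bvec_orthogonal.
  by rewrite add0r; field.
by rewrite !formE mulfVK // subrr.
Qed.

End ScalarFlagCurvature.

End LocalGeometry.

(** * Change of charts *)

Section ChangeOfCoordinates.
Variables (R : realType) (n : nat).
Local Notation V := 'rV[R]_n.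
Variables (O : set V) (phi : V -> V).
Hypothesis Oopen : open O.
Hypothesis phi_smooth : forall q, smooth_on O (fun z => phi z 0 q).
Implicit Types (u v w x z : V).

Lemma differentiable_coords z : O z -> differentiable phi z.
Proof.
move=> Oz.
have -> : phi = \sum_q (fun z => phi z 0 q *: (delta_mx 0 q : V)).
  by apply/funext => y; rewrite [LHS]row_sum_delta fct_sumE.
apply: differentiable_sum => q; apply: differentiableZl.
exact: smooth_differentiable (phi_smooth q) Oz.
Qed.

Lemma mul_jacobian z w q : O z -> (w *m 'J phi z) 0 q = 'D_w (fun y => phi y 0 q) z.
Proof.
move=> Oz; have dphi := differentiable_coords Oz.
rewrite -deriveEjacobian // derive_mx; last exact: diff_derivable.
by rewrite mxE.
Qed.

Lemma derive_pullback (f : V -> R) x v : O x -> differentiable f (phi x) ->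
  'D_v (fun z => f (phi z)) x = 'D_(v *m 'J phi x) f (phi x).
Proof.
move=> Ox fd; have dphi := differentiable_coords Ox.
rewrite -[fun z => _]/(f \o phi) deriveE; last exact: differentiable_comp.
by rewrite diff_comp //= -(deriveE v dphi) deriveEjacobian // deriveE.
Qed.

Variables (a a' : V -> 'M[R]_n) (b b' : V -> V) (U U' : set V).
Hypotheses (L : killing_chart U a b) (L' : killing_chart U' a' b').
Hypotheses (OU : forall z, O z -> U z) (OU' : forall z, O z -> U' (phi z)).
Hypothesis bE : forall z, O z -> b z = b' (phi z) *m ('J phi z)^T.
Hypothesis aE : forall z, O z -> a z = 'J phi z *m a' (phi z) *m ('J phi z)^T.
Variable x : V.
Hypothesis Ox : O x.
Local Notation J := ('J phi x).

Lemma lf_pullback z w : O z -> lf (b z) w = lf (b' (phi z)) (w *m 'J phi z).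
Proof. by move=> Oz; rewrite !lfE bE // -mulmxA trmx_mul. Qed.

Lemma bf_pullback v w : bf (a x) v w = bf (a' (phi x)) (v *m J) (w *m J).
Proof. by rewrite !bfE aE // trmx_mul !mulmxA. Qed.

(* The second derivatives of the transition map are the only non-tensorial
   contribution; they are symmetric in [v] and [w]. *)
Lemma lf_drow_pullback v w (D2 : 'I_n -> R) :
  (forall q, 'D_v ('D_w (fun z => phi z 0 q)) x = D2 q) ->
  lf (drow b v x) w =
  lf (drow b' (v *m J) (phi x)) (w *m J) + \sum_q b' (phi x) 0 q * D2 q.
Proof.
move=> D2E.
have bd i : differentiable (fun z => b z 0 i) x.
  exact: smooth_differentiable (kc_form_smooth L i) (OU Ox).
have b'd i : differentiable (fun z => b' z 0 i) (phi x).
  exact: smooth_differentiable (kc_form_smooth L' i) (OU' Ox).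
rewrite -(derive_val (is_derive := is_derive_lf_field v w bd)).
rewrite (@near_eq_derive _ _ _ _
  (fun z => \sum_q b' (phi z) 0 q * 'D_w (fun y => phi y 0 q) z)); last first.
  near=> z; have Oz : O z by near: z; exact: near_open.
  by rewrite lf_pullback // lf.unlock; apply: eq_bigr => q _; rewrite mul_jacobian.
have bD q : is_derive x v (fun z => b' (phi z) 0 q) ('D_(v *m J) (fun z => b' z 0 q) (phi x)).
  rewrite -(derive_pullback (f := fun z => b' z 0 q)) //; apply: derivableP.
  apply: diff_derivable; apply: (@differentiable_comp _ _ _ _ phi (fun z => b' z 0 q)) => //.
  exact: differentiable_coords.
have pD q : is_derive x v ('D_w (fun y => phi y 0 q)) (D2 q).
  rewrite -D2E.
  apply: derivableP; apply: diff_derivable.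
  exact: differentiable_derive (phi_smooth q) Ox.
have D := is_derive_sum_pt (fun q => is_deriveM_pt (bD q) (pD q)).
rewrite (derive_val (is_derive := D)) big_split addrC lf.unlock; congr (_ + _).
by apply: eq_bigr => q _; rewrite drowE mul_jacobian // mulrC.
Unshelve. all: by end_near. Qed.

(** Up to sign, s is half the exterior derivative of b: the Christoffel symbols drop out in [curl],
    and the second derivatives of the transition map, being symmetric, cancel. *)
Lemma smat_pullback v w : bf (smat a b x) w v = bf (smat a' b' (phi x)) (w *m J) (v *m J).
Proof.
have curl (p : V) (A : V -> 'M[R]_n) (c : V -> V) (W : set V) (LW : killing_chart W A c) (y z : V) :
    W p -> 2 * bf (smat A c p) z y = lf (drow c y p) z - lf (drow c z p) y.
  move=> Wp; rewrite !(lf_drow LW) // (GamC LW z y Wp).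
  by rewrite (bf_anti y z (smat_anti A c p)); ring.
have E := curl _ _ _ _ L v w (OU Ox).
have E' := curl _ _ _ _ L' (v *m J) (w *m J) (OU' Ox).
have [s [H1 H2]] : exists s,
    lf (drow b v x) w = lf (drow b' (v *m J) (phi x)) (w *m J) + s /\
    lf (drow b w x) v = lf (drow b' (w *m J) (phi x)) (v *m J) + s.
  pose D2 q := 'D_v ('D_w (fun z => phi z 0 q)) x.
  exists (\sum_q b' (phi x) 0 q * D2 q); split.
    exact: lf_drow_pullback.
  exact: lf_drow_pullback (fun q => smooth_derive_comm Oopen v w (phi_smooth q) Ox).
have two0 : (2 : R) != 0 by rewrite pnatr_eq0.
by apply: (mulfI two0); rewrite E E' H1 H2; ring.
Qed.

(** Read off from the transformation law of the metric: J is a factor of the invertible matrix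
    [a x]. *)
Lemma jacobian_unit : J \in unitmx.
Proof.
have au : a x \in unitmx by apply: unitmx_pos; exact: kc_pos L _ (OU Ox).
by move: au; rewrite aE // !unitmx_mul => /andP[/andP[]].
Qed.

Lemma bvec_pullback : bvec a b x *m J = bvec a' b' (phi x).
Proof.
apply: (bf_inj (kc_pos L' (OU' Ox))) => z.
rewrite -[z](mulmxKV jacobian_unit) -bf_pullback !(lf_bvec L, lf_bvec L') ?lf_pullback //.
- exact: OU'.
- exact: OU.
Qed.

Lemma sharp_pullback v : sharp a b x v *m J = sharp a' b' (phi x) (v *m J).
Proof.
apply: (bf_inj (kc_pos L' (OU' Ox))) => z.
rewrite -[z](mulmxKV jacobian_unit) -bf_pullback (bf_sharp L) ?(bf_sharp L') ?smat_pullback //.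
- exact: OU'.
- exact: OU.
Qed.

End ChangeOfCoordinates.

(** The factor of beta in [t0_proportional]. Being built from scalar products of vectors attached to
    s and b, it can be compared between charts. *)
Definition t_ratio (R : realType) (n : nat) (a : 'rV[R]_n -> 'M[R]_n)
    (b : 'rV[R]_n -> 'rV[R]_n) (x : 'rV[R]_n) : R :=
  - (bf (a x) (sharp a b x (bvec a b x)) (sharp a b x (bvec a b x))
     / bf (a x) (bvec a b x) (bvec a b x)).

(** * The factor of proportionality as a function on the manifold *)

Section Manifold.
Variables (R : realType) (n : nat) (M : topologicalType).
Variables (A : smooth_manifold R n M) (a : riemannian_metric A) (b : one_form A).
Hypotheses (hb1 : norm_lt1 a b) (hkilling : killing a b).

Lemma chart_killing i : killing_chart (chart_map i @` chart_dom i) (a i) (b i).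
Proof.
split.
- exact: mf_image_open.
- exact: met_smooth.
- exact: form_smooth.
- by move=> _ [p ip <-]; exact: met_sym.
- by move=> _ [p ip <-] y y0; rewrite bfE; exact: met_pos.
- by move=> _ [p ip <-]; exact: hb1.
- by move=> _ [p ip <-]; exact: hkilling.
Qed.

Lemma open_chart_overlap (i j : chart A) :
  open (chart_map i @` (chart_dom i `&` chart_dom j)).
Proof.
rewrite openE => _ [p [ip jp] <-].
have imo := @mf_image_open _ _ _ A i.
have := @mf_param_continuous _ _ _ A i; rewrite continuous_open_subspace //.
move=> ci; have imp : (chart_map i @` chart_dom i) (chart_map i p) by exists p.
have cp : {for chart_map i p, continuous (chart_inv i)} by apply: ci; rewrite inE.
have nj : nbhs (chart_inv i (chart_map i p)) (chart_dom j).
  by rewrite mf_coordK //; apply: open_nbhs_nbhs; split => //; exact: mf_dom_open.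
have ni : nbhs (chart_map i p) (chart_map i @` chart_dom i) by exact: open_nbhs_nbhs.
apply: filterS2 ni (cp _ nj) => _ [q iq <-] /=.
by rewrite mf_coordK // => jq; exists q.
Qed.

Lemma t_ratio_chart i j p : chart_dom i p -> chart_dom j p ->
  t_ratio (a i) (b i) (chart_map i p) = t_ratio (a j) (b j) (chart_map j p).
Proof.
move=> ip jp; set O := chart_map i @` (chart_dom i `&` chart_dom j).
pose phi := chart_map j \o chart_inv i.
have Oo : open O by exact: open_chart_overlap.
have ps q : smooth_on O (fun z => phi z 0 q) by exact: mf_transition_smooth.
have Li := chart_killing i; have Lj := chart_killing j.
have OU z : O z -> (chart_map i @` chart_dom i) z by move=> [q [iq _] <-]; exists q.
have OU' z : O z -> (chart_map j @` chart_dom j) (phi z).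
  by move=> [q [iq jq] <-]; rewrite /phi /= mf_coordK //; exists q.
have bE z : O z -> b i z = b j (phi z) *m ('J phi z)^T.
  move=> [q [iq jq] <-]; rewrite (form_trans b iq jq) /phi /= mf_coordK //.
have aE z : O z -> a i z = 'J phi z *m a j (phi z) *m ('J phi z)^T.
  move=> [q [iq jq] <-]; rewrite (met_trans a iq jq) /phi /= mf_coordK //.
have Op : O (chart_map i p) by exists p.
have pE : phi (chart_map i p) = chart_map j p by rewrite /phi /= mf_coordK.
have bfp := bf_pullback aE Op.
rewrite /t_ratio !bfp (bvec_pullback Li Lj OU OU' bE aE Op).
rewrite (sharp_pullback Oo ps Li Lj OU OU' bE aE Op).
by rewrite (bvec_pullback Li Lj OU OU' bE aE Op) pE.
Qed.

End Manifold.

Theorem theorem1p2 (R : realType) (n : nat) (M : topologicalType)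
    (A : smooth_manifold R n M) (a : riemannian_metric A) (b : one_form A)
    (K : slit_function A)
    (hb0 : nowhere_vanishing b)
    (hb1 : norm_lt1 a b)
    (hkilling : killing a b)
    (hscalar : scalar_flag_curvature (fun i => randers (a i) (b i)) K) :
  exists c lambda : M -> R,
    forall (p : M) (i : chart A), chart_dom i p -> forall y : 'rV[R]_n,
      t0 (a i) (b i) (chart_map i p) y =
      - ((n%:R - 1) / (n%:R + 1)) *
        (lambda p + c p * (beta_norm (a i) (b i) (chart_map i p)) ^- 2) *
        beta (b i) (chart_map i p) y.
Proof.
(* An arbitrary chart around each point is chosen; [t_ratio_chart] makes the value independent of
   it. *)
pose mu p := let i := projT1 (cid (mf_cover A p)) in
  t_ratio (a i) (b i) (chart_map i p).
(* The solution of mu = - (n - 1) / (n + 1) lambda when n differs from 1. For n = 1 division by zero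
   gives lambda = 0, and both sides of the claim are zero. *)
exists (fun=> 0), (fun p => - ((n%:R + 1) / (n%:R - 1)) * mu p) => p i ip y.
have L := chart_killing hb1 hkilling i.
have Ux : (chart_map i @` chart_dom i) (chart_map i p) by exists p.
have t0mu : t0 (a i) (b i) (chart_map i p) y = mu p * beta (b i) (chart_map i p) y.
  rewrite /mu; case: cid => j /= jp.
  rewrite -(t_ratio_chart hb1 hkilling ip jp).
  apply: (t0_proportional L Ux (hb0 i p ip)).
  move=> z z0; exists (K i (chart_map i p) z) => u; exact: hscalar.
have [n1|n1] := eqVneq n 1%N.
  have ord_0 (k : 'I_n) : val k = 0%N.
    by apply/eqP; rewrite -leqn0 -ltnS; exact: leq_trans (ltn_ord k) (eq_leq n1).
  have s0 : smat (a i) (b i) (chart_map i p) = 0.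
    apply/matrixP => k l; have -> : k = l by apply: val_inj; rewrite !ord_0.
    by rewrite !mxE /s_low subrr mulr0.
  have S0 : sharp (a i) (b i) (chart_map i p) y = 0.
    apply: (bf_inj (kc_pos L Ux)) => z.
    by rewrite (bf_sharp L) // s0 bf0l bfE mulmx0 mul0mx mxE.
  have n10 : n%:R - 1 = 0 :> R by apply/eqP; rewrite subr_eq0 (eqr_nat R n 1); exact/eqP.
  by rewrite (t0E L) // S0 bf0r n10 !mul0r oppr0 !mul0r.
rewrite mul0r addr0 t0mu; congr (_ * _).
have n10 : n%:R - 1 != 0 :> R by rewrite subr_eq0 (eqr_nat R n 1).
have np0 : n%:R + 1 != 0 :> R by rewrite natr1 pnatr_eq0.
by field; rewrite n10 np0.
Qed.
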